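(* Let $(L,Q)$, $(L',Q')$, $(L'',Q'')$ be $L_\infty$-algebras, let $F_0,F_1$ be two homotopic $L_\infty$-morphisms from $(L,Q)$ to $(L',Q')$, and let $H$ be an $L_\infty$-morphism from $(L',Q')$ to $(L'',Q'')$. Then the $L_\infty$-morphisms $HF_0$ and $HF_1$ from $(L,Q)$ to $(L'',Q'')$ are homotopic, $HF_0\sim HF_1$.
   Context: Everything is over a field $\mathbb K$ of characteristic $0$. $L[1]^k=L^{k+1}$; $\overline{\mathrm{Sym}}(L[1])=\bigoplus_{n\ge1}\mathrm{Sym}^n(L[1])$ is the cofree graded cocommutative coalgebra without counit, with coproduct $\overline\Delta$ (sum over unshuffles with Koszul signs) and iterated coproducts $\overline\Delta^{n-1}$ with values in $n$ tensor factors. An $L_\infty$-algebra $(L,Q)$ is a graded vector space $L$ with a degree $+1$ coderivation $Q$ of $\overline{\mathrm{Sym}}(L[1])$, $Q^2=0$, with components $Q_n^1\colon\mathrm{Sym}^n(L[1])\to L[2]$. An $L_\infty$-morphism is a degree $0$ coalgebra morphism $F$ with $FQ=Q'F$; it is determined by its components $F^1_n\colon\mathrm{Sym}^n(L[1])\to L'[1]$. Convolution $L_\infty$-algebra: $\mathcal H=\mathrm{Hom}(\overline{\mathrm{Sym}}(L[1]),L')$ (graded linear maps; if $L,L'$ carry complete descending filtrations, maps and $L_\infty$-morphisms are required to be compatible with them) has the $L_\infty$-structure $\widehat Q$ with $\widehat Q^1_1F=Q'^1_1\circ F-(-1)^{|F|}F\circ Q$ and $\widehat Q^1_n(F_1\vee\cdots\vee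 F_n)=(Q')^1_n\circ\vee^{n-1}\circ(F_1\otimes\cdots\otimes F_n)\circ\overline\Delta^{n-1}$ for $n\ge2$, with $|F|$ the degree in $\mathcal H[1]$. It has the complete filtration $\mathcal F^k\mathcal H=\{f: f|_{\mathrm{Sym}^{<k}(L[1])}=0\}$, $\mathcal F^1\mathcal H=\mathcal H$. Its Maurer--Cartan elements ($F\in(\mathcal H[1])^0$ with $\sum_{n>0}\frac1{n!}\widehat Q^1_n(F\vee\cdots\vee F)=0$) are identified with $L_\infty$-morphisms. Two $L_\infty$-morphisms are homotopic ($\sim$) if they are related by the transitive closure of the relation: there exist $F(t)\in\widehat{(\mathcal H[1])^0[t]}$ and $\lambda(t)\in\widehat{(\mathcal H[1])^{-1}[t]}$ with $\frac{d}{dt}F(t)=\sum_{n\ge0}\frac1{n!}\widehat Q^1_{n+1}(\lambda(t)\vee F(t)\vee\cdots\vee F(t))$, $F(0)=F_0$, $F(1)=F_1$. Here $\widehat{V[t]}\subseteq V[[t]]$ denotes the series that are polynomial in $t$ modulo $\mathcal F^n$ for every $n$. *)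

(* Defs.v *)
From HB Require Import structures.
From mathcomp Require Import all_boot all_order all_algebra.
From mathcomp Require Import boolp.
From Stdlib Require Import Relation_Operators.

Set Implicit Arguments.
Unset Strict Implicit.
Unset Printing Implicit Defensive.

Import Order.TTheory GRing.Theory Num.Theory.
Local Open Scope ring_scope.
Local Open Scope quotient_scope.

(* Modules presented by generators and relations: a pair [R x t] imposes      *)
(* x = \sum_((a, y) in t) a y, and [presented R] is the quotient of the       *)
(* formal linear combinations of elements of X by the congruence generated    *)
(* by R and by the module axioms.                                             *)

Section Presentation.
Variables (K : fieldType) (X : choiceType) (R : X -> seq (K * X) -> Prop).

Definition fscale (a : K) (s : seq (K * X)) := [seq (a * p.1, p.2) | p <- s].

Inductive fcong : seq (K * X) -> seq (K * X) -> Prop :=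
| fcong_refl s : fcong s s
| fcong_sym s t : fcong s t -> fcong t s
| fcong_trans t s u : fcong s t -> fcong t u -> fcong s u
| fcong_cat s s' t t' : fcong s s' -> fcong t t' -> fcong (s ++ t) (s' ++ t')
| fcong_scale a s s' : fcong s s' -> fcong (fscale a s) (fscale a s')
| fcong_catC s t : fcong (s ++ t) (t ++ s)
| fcong_add a b x : fcong [:: (a, x); (b, x)] [:: (a + b, x)]
| fcong_zero x : fcong [:: (0, x)] [::]
| fcong_rel x t : R x t -> fcong [:: (1, x)] t.

Definition fequiv : rel (seq (K * X)) := fun s t => `[< fcong s t >].

Lemma fequiv_class : equiv_class_of fequiv.
Proof.
split=> [s | s t | t s u].
- exact/asboolP/fcong_refl.
- by apply/asboolP/asboolP=> /fcong_sym.
- by move=> /asboolP st /asboolP tu; apply/asboolP/(fcong_trans st tu).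
Qed.

Canonical fequiv_equiv := EquivRelPack fequiv_class.
Canonical fequiv_encModRel := defaultEncModRel fequiv.

Definition presented := {eq_quot fequiv}.
HB.instance Definition _ : EqQuotient _ fequiv presented :=
  EqQuotient.on presented.
HB.instance Definition _ := Choice.on presented.

Definition padd (x y : presented) : presented := \pi_presented (repr x ++ repr y).
Definition pscale (a : K) (x : presented) : presented :=
  \pi_presented (fscale a (repr x)).
Definition pzero : presented := \pi_presented [::].
Definition popp (x : presented) : presented := pscale (-1) x.

Lemma pi_cong s t : fcong s t -> \pi_presented s = \pi_presented t .
Proof. by move=> st; apply/eqmodP/asboolP. Qed.

Lemma cong_pi s t : \pi_presented s = \pi_presented t  -> fcong s t.
Proof. by move/eqmodP/asboolP. Qed.

Lemma repr_pi s : fcong (repr (\pi_presented s)) s.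
Proof. by apply: cong_pi; rewrite reprK. Qed.

Lemma presP (x : presented) : exists s, x = \pi_presented s.
Proof. by exists (repr x); rewrite reprK. Qed.

Lemma padd_pi s t : padd (\pi_presented s) (\pi_presented t) = \pi_presented (s ++ t).
Proof. by apply: pi_cong; apply: fcong_cat; apply: repr_pi. Qed.

Lemma pscale_pi a s : pscale a (\pi_presented s) = \pi_presented (fscale a s).
Proof. by apply: pi_cong; apply: fcong_scale; apply: repr_pi. Qed.

Lemma paddA : associative padd.
Proof.
move=> x y z; have [s ->] := presP x; have [t ->] := presP y; have [u ->] := presP z.
by rewrite !padd_pi catA.
Qed.

Lemma paddC : commutative padd.
Proof.
move=> x y; have [s ->] := presP x; have [t ->] := presP y.
by rewrite !padd_pi; apply/pi_cong/fcong_catC.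
Qed.

Lemma padd0 : left_id pzero padd.
Proof. by move=> x; have [s ->] := presP x; rewrite padd_pi. Qed.

Lemma fscaleDl a b s : fcong (fscale a s ++ fscale b s) (fscale (a + b) s).
Proof.
elim: s => [|[c x] s IHs] /=; first exact: fcong_refl.
set A := fscale a s in IHs *; set B := fscale b s in IHs *.
have h1 : fcong ((a * c, x) :: A ++ (b * c, x) :: B)
                ([:: (a * c, x); (b * c, x)] ++ (A ++ B)).
  rewrite -[_ :: _ ++ _]/([:: (a * c, x)] ++ (A ++ ([:: (b * c, x)] ++ B))).
  rewrite -[[:: _; _] ++ _]/([:: (a * c, x)] ++ ([:: (b * c, x)] ++ (A ++ B))).
  apply: fcong_cat; first exact: fcong_refl.
  rewrite !catA; apply: fcong_cat; last exact: fcong_refl.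
  exact: fcong_catC.
apply: (fcong_trans h1); rewrite mulrDl.
by apply: (fcong_cat (fcong_add _ _ _) IHs).
Qed.

Lemma fscale0 s : fcong (fscale 0 s) [::].
Proof.
elim: s => [|[c x] s IHs] /=; first exact: fcong_refl.
rewrite mul0r; exact: (fcong_cat (fcong_zero x) IHs).
Qed.

Lemma fscale1 s : fscale 1 s = s.
Proof. by elim: s => [|[c x] s IHs] //=; rewrite mul1r IHs. Qed.

Lemma paddN : left_inverse pzero popp padd.
Proof.
move=> x; have [s ->] := presP x; rewrite /popp pscale_pi padd_pi -{2}(fscale1 s).
apply/pi_cong/(fcong_trans (fscaleDl _ _ _)); rewrite addNr; exact: fscale0.
Qed.

HB.instance Definition _ := GRing.isZmodule.Build presented
  paddA paddC padd0 paddN.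

Lemma paddE (x y : presented) : x + y = padd x y. Proof. by []. Qed.

Lemma pscaleA a b (x : presented) : pscale a (pscale b x) = pscale (a * b) x.
Proof.
have [s ->] := presP x; rewrite !pscale_pi /fscale -map_comp; congr (\pi _).
by apply: eq_map => p /=; rewrite mulrA.
Qed.

Lemma pscale1 : left_id 1 pscale.
Proof. by move=> x; have [s ->] := presP x; rewrite pscale_pi fscale1. Qed.

Lemma pscaleDr : right_distributive pscale +%R.
Proof.
move=> a x y; have [s ->] := presP x; have [t ->] := presP y.
rewrite !paddE padd_pi !pscale_pi padd_pi.
by rewrite /fscale map_cat.
Qed.

Lemma pscaleDl (x : presented) : {morph pscale^~ x : a b / a + b}.
Proof.
have [s ->] := presP x; move=> a b; rewrite !pscale_pi paddE padd_pi.
exact/pi_cong/fcong_sym/fscaleDl.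
Qed.

HB.instance Definition _ := GRing.Zmodule_isLmodule.Build K presented
  pscaleA pscale1 pscaleDr pscaleDl.

Lemma pscaleE a (x : presented) : a *: x = pscale a x. Proof. by []. Qed.

Definition pgen (x : X) : presented := \pi_presented [:: (1, x)].

Lemma pi_sum s : \pi_presented s = \sum_(p <- s) p.1 *: pgen p.2 .
Proof.
elim: s => [|[a x] s IHs]; first by rewrite big_nil.
rewrite big_cons -IHs /= pscaleE pscale_pi paddE padd_pi /=.
by rewrite mulr1.
Qed.

Lemma pres_sum (z : presented) : z = \sum_(p <- repr z) p.1 *: pgen p.2.
Proof. by rewrite -pi_sum reprK. Qed.

Lemma pgen_rel x t : R x t -> pgen x = \sum_(p <- t) p.1 *: pgen p.2.
Proof. by move=> Rxt; rewrite -pi_sum; apply/pi_cong/fcong_rel. Qed.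

Section Lift.
Variables (W : lmodType K) (f : X -> W).

Definition respects := forall x t, R x t -> f x = \sum_(p <- t) p.1 *: f p.2.

Hypothesis Hf : respects.

Definition plift_fun (z : presented) : W := \sum_(p <- repr z) p.1 *: f p.2.

Lemma sum_fscale a s :
  \sum_(p <- fscale a s) p.1 *: f p.2 = a *: \sum_(p <- s) p.1 *: f p.2.
Proof.
by rewrite big_map scaler_sumr; apply: eq_bigr => p _; rewrite scalerA.
Qed.

Lemma fcong_sum s t : fcong s t ->
  \sum_(p <- s) p.1 *: f p.2 = \sum_(p <- t) p.1 *: f p.2.
Proof.
elim=> {s t} //.
- by move=> t s u _ -> _ ->.
- by move=> s s' t t' _ IHs _ IHt; rewrite !big_cat IHs IHt.
- by move=> a s s' _ IHs; rewrite !sum_fscale IHs.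
- by move=> s t; rewrite !big_cat /= addrC.
- by move=> a b x; rewrite big_cons !big_seq1 scalerDl.
- by move=> x; rewrite big_seq1 big_nil scale0r.
- by move=> x t Rxt; rewrite big_seq1 scale1r; apply: Hf.
Qed.

Lemma plift_pi s : plift_fun (\pi_presented s) = \sum_(p <- s) p.1 *: f p.2.
Proof. exact/fcong_sum/repr_pi. Qed.

Lemma plift_is_linear : linear plift_fun.
Proof.
move=> a x y; have [s ->] := presP x; have [t ->] := presP y.
by rewrite pscaleE pscale_pi paddE padd_pi !plift_pi big_cat sum_fscale.
Qed.

Definition plift of respects := plift_fun.

HB.instance Definition _ :=
  GRing.isLinear.Build K presented W _ (plift Hf) plift_is_linear.

Lemma pliftE x : plift Hf (pgen x) = f x.
Proof. by rewrite /plift plift_pi big_seq1 scale1r. Qed.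

End Lift.

Lemma plin_ext (W : lmodType K) (f g : {linear presented -> W}) :
  (forall x, f (pgen x) = g (pgen x)) -> f =1 g.
Proof.
move=> fg z; rewrite (pres_sum z) !linear_sum; apply: eq_bigr => p _.
by rewrite !linearZ /= fg.
Qed.

End Presentation.

Arguments pgen {K X} R x.
Arguments plift {K X R W f} Hf z.

Section Tensor.
Variable K : fieldType.

Inductive tensor_rel (M N : lmodType K) : M * N -> seq (K * (M * N)) -> Prop :=
| tensor_linl a x x' y :
    tensor_rel (a *: x + x', y) [:: (a, (x, y)); (1, (x', y))]
| tensor_linr a x y y' :
    tensor_rel (x, a *: y + y') [:: (a, (x, y)); (1, (x, y'))].

Definition tensor (M N : lmodType K) : lmodType K := presented (@tensor_rel M N).

Definition tens (M N : lmodType K) (x : M) (y : N) : tensor M N :=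
  pgen (@tensor_rel M N) (x, y).

Lemma tens_linl (M N : lmodType K) a (x x' : M) (y : N) :
  tens (a *: x + x') y = a *: tens x y + tens x' y.
Proof.
by rewrite /tens (pgen_rel (tensor_linl a x x' y)) big_cons big_seq1 scale1r.
Qed.

Lemma tens_linr (M N : lmodType K) a (x : M) (y y' : N) :
  tens x (a *: y + y') = a *: tens x y + tens x y'.
Proof.
by rewrite /tens (pgen_rel (tensor_linr a x y y')) big_cons big_seq1 scale1r.
Qed.

Lemma tmap_respects (M N M' N' : lmodType K)
  (f : {linear M -> M'}) (g : {linear N -> N'}) :
  respects (@tensor_rel M N) (fun p => tens (f p.1) (g p.2)).
Proof.
move=> x t []{x t} a x y z; rewrite big_cons big_seq1 /= scale1r linearP.
  exact: tens_linl.
exact: tens_linr.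
Qed.

(* No sign is inserted here: see [ctens] below for the Koszul rule.           *)
Definition tmap (M N M' N' : lmodType K)
    (f : {linear M -> M'}) (g : {linear N -> N'}) :
  tensor M N -> tensor M' N' := plift (@tmap_respects M N M' N' f g).

HB.instance Definition _ (M N M' N' : lmodType K)
    (f : {linear M -> M'}) (g : {linear N -> N'}) :=
  GRing.isLinear.Build K _ _ _ (tmap f g)
    (plift_is_linear (@tmap_respects M N M' N' f g)).

Lemma tmapE (M N M' N' : lmodType K)
    (f : {linear M -> M'}) (g : {linear N -> N'}) x y :
  tmap f g (tens x y) = tens (f x) (g y).
Proof. exact: pliftE. Qed.

Lemma tmap_comp (M N M1 N1 M2 N2 : lmodType K)
    (f : {linear M1 -> M2}) (g : {linear N1 -> N2})
    (f' : {linear M -> M1}) (g' : {linear N -> N1}) z :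
  tmap f g (tmap f' g' z) = tmap (f \o f') (g \o g') z.
Proof.
have e : (tmap f g \o tmap f' g') =1 tmap (f \o f') (g \o g').
  apply: plin_ext => -[x y].
  change (tmap f g (tmap f' g' (tens x y)) = tmap (f \o f') (g \o g') (tens x y)).
  by rewrite !tmapE.
exact: e.
Qed.

(* [tpow M n] is the (n+1)-fold tensor power of M. *)
Fixpoint tpow (M : lmodType K) (n : nat) : lmodType K :=
  if n is n'.+1 then tensor M (tpow M n') else M.

End Tensor.

(* Graded vector spaces: [gpr i] is the projection onto the component of      *)
(* degree i, and [gfin] says that the space is the direct sum of these.       *)
Record graded (K : fieldType) := Graded {
  gcar :> lmodType K;
  gpr : int -> {linear gcar -> gcar};
  gprK : forall i j v, gpr i (gpr j v) = if i == j then gpr j v else 0;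
  gfin : forall v, exists2 s : seq int, uniq s & v = \sum_(i <- s) gpr i v
}.
Arguments gpr {K g} i.

Section Graded.
Variable K : fieldType.

Definition homog (V : graded K) (i : int) (v : V) : Prop := gpr i v = v.

Definition of_degree (V W : graded K) (d : int) (f : V -> W) : Prop :=
  forall i v, homog i v -> homog (i + d) (f v).

Lemma shift_gprK (V : graded K) (i j : int) (v : V) :
  gpr (i + 1) (gpr (j + 1) v) = if i == j then gpr (j + 1) v else 0.
Proof. by rewrite gprK (inj_eq (addIr _)). Qed.

Lemma shift_gfin (V : graded K) (v : V) :
  exists2 s : seq int, uniq s & v = \sum_(i <- s) gpr (i + 1) v.
Proof.
have [s us vE] := gfin v; exists [seq i - 1 | i <- s].
  by rewrite map_inj_uniq //; apply: addIr.
by rewrite big_map {1}vE; apply: eq_bigr => i _; rewrite subrK.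
Qed.

(* L[1]: same carrier, with L[1]^k = L^(k + 1). *)
Definition shift1 (V : graded K) : graded K :=
  @Graded K V (fun k => gpr (k + 1)) (@shift_gprK V) (@shift_gfin V).

Definition filtered_sub (V : graded K) (F : int -> V -> Prop) : Prop :=
  [/\ forall k, F k 0,
      forall k a u v, F k u -> F k v -> F k (a *: u + v) &
      forall k i v, F k v -> F k (gpr i v)].

(* Complete descending filtrations by graded subspaces, indexed by int.       *)
(* Completeness is degreewise, i.e. in the category of graded vector spaces.  *)
Record filtration (V : graded K) := Filtration {
  fil :> int -> V -> Prop;
  fil_sub : filtered_sub fil;
  fil_desc : forall k v, fil (k + 1) v -> fil k v;
  fil_sep : forall v, (forall k, fil k v) -> v = 0;
  fil_compl : forall i (u : nat -> V),
    (forall n, homog i (u n)) -> (forall n, fil n%:Z (u n.+1 - u n)) ->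
    exists2 v, homog i v & forall n, fil n%:Z (v - u n)
}.

(* A space without filtration is handled through the filtration with          *)
(* F^k = V for k <= 0 and F^k = 0 for k > 0, for which the compatibility      *)
(* conditions below are void: see [trivial_sym_fil].                          *)
Definition triv_fil (V : graded K) (k : int) (v : V) : Prop :=
  0 < k -> v = 0.

Lemma triv_fil_sub (V : graded K) : filtered_sub (@triv_fil V).
Proof.
split=> [k _|k a u v hu hv k0|k i v hv k0] //.
  by rewrite hu // hv // scaler0 addr0.
by rewrite hv // linear0.
Qed.

Lemma triv_fil_desc (V : graded K) k (v : V) :
  triv_fil (k + 1) v -> triv_fil k v.
Proof. by move=> h k0; apply: h; apply: addr_gt0. Qed.

Lemma triv_fil_sep (V : graded K) (v : V) : (forall k, triv_fil k v) -> v = 0.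
Proof. by move=> /(_ 1); apply. Qed.

Lemma triv_fil_compl (V : graded K) i (u : nat -> V) :
  (forall n, homog i (u n)) ->
  (forall n, triv_fil n%:Z (u n.+1 - u n)) ->
  exists2 v, homog i v & forall n, triv_fil n%:Z (v - u n).
Proof.
move=> hu du; exists (u 1); first exact: hu.
elim=> [|[|n] IHn] // _; first by rewrite subrr.
have /eqP := IHn isT; rewrite subr_eq0 => /eqP ->.
have /eqP := du n.+1 isT; rewrite subr_eq0 => /eqP ->.
exact: subrr.
Qed.

Definition trivial_filtration (V : graded K) : filtration V :=
  Filtration (@triv_fil_sub V) (@triv_fil_desc V) (@triv_fil_sep V)
    (@triv_fil_compl V).

End Graded.

Section SymmetricCoalgebra.
Variables (K : fieldType) (V : graded K).

(* The word (i1, v1) ... (in, vn) stands for gpr i1 v1 \/ ... \/ gpr in vn.   *)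
Definition word := seq (int * V).

Definition wdeg (w : word) : int := \sum_(x <- w) x.1.

Inductive word_rel : word -> seq (K * word) -> Prop :=
| word_lin i a u v w :
    word_rel ((i, a *: u + v) :: w) [:: (a, (i, u) :: w); (1, (i, v) :: w)]
| word_hom i v w : word_rel ((i, v) :: w) [:: (1, (i, gpr i v) :: w)]
| word_swap i u j v w :
    word_rel ((i, u) :: (j, v) :: w)
             [:: ((-1) ^ (i * j), (j, v) :: (i, u) :: w)]
| word_cons x w t :
    word_rel w t -> word_rel (x :: w) [seq (p.1, x :: p.2) | p <- t].

(* The empty word is killed: the coalgebra has no counit. *)
Definition sym_rel (w : word) (t : seq (K * word)) : Prop :=
  (w = [::] /\ t = [::]) \/ word_rel w t.

Definition Sym : lmodType K := presented sym_rel.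

Definition wgen (w : word) : Sym := pgen sym_rel w.

Lemma wgen_nil : wgen [::] = 0.
Proof.
by have := @pgen_rel K word sym_rel [::] [::] (or_introl (conj erefl erefl));
  rewrite big_nil.
Qed.

Lemma wgen_rel w t : word_rel w t -> wgen w = \sum_(p <- t) p.1 *: wgen p.2.
Proof. by move=> wt; apply: pgen_rel; right. Qed.

Lemma wdeg_cons x w : wdeg (x :: w) = x.1 + wdeg w.
Proof. by rewrite /wdeg big_cons. Qed.

Lemma wdeg_cat w w' : wdeg (w ++ w') = wdeg w + wdeg w'.
Proof. by rewrite /wdeg big_cat. Qed.

Lemma word_rel_deg w t : word_rel w t -> forall p, p \in t -> wdeg p.2 = wdeg w.
Proof.
elim=> {w t} [i a u v w p|i v w p|i u j v w p|x w t _ IH p].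
- by rewrite !inE => /orP[] /eqP->; rewrite !wdeg_cons.
- by rewrite !inE => /eqP->; rewrite !wdeg_cons.
- by rewrite !inE => /eqP->; rewrite !wdeg_cons /= addrCA.
- by case/mapP => q qt ->; rewrite /= !wdeg_cons IH.
Qed.

Lemma word_rel_size w t : word_rel w t ->
  forall p, p \in t -> size p.2 = size w.
Proof.
elim=> {w t} [i a u v w p|i v w p|i u j v w p|x w t _ IH p].
- by rewrite !inE => /orP[] /eqP->.
- by rewrite !inE => /eqP->.
- by rewrite !inE => /eqP->.
- by case/mapP => q qt ->; rewrite /= IH.
Qed.

Lemma word_rel_neq0 w t : word_rel w t -> size w != 0%N.
Proof. by case. Qed.

Lemma sym_respects (W : lmodType K) (f : word -> W) : f [::] = 0 ->
  (forall w t, word_rel w t -> f w = \sum_(p <- t) p.1 *: f p.2) ->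
  respects sym_rel f.
Proof.
by move=> f0 fr w t [[-> ->]|/fr //]; rewrite big_nil.
Qed.

Lemma scalef_respects (c : int -> nat -> K) :
  respects sym_rel (fun w => c (wdeg w) (size w) *: wgen w).
Proof.
apply: sym_respects => [|w t wt]; first by rewrite wgen_nil scaler0.
rewrite (wgen_rel wt) scaler_sumr big_seq [RHS]big_seq.
apply: eq_bigr => p pt; rewrite (word_rel_deg wt pt) (word_rel_size wt pt).
by rewrite !scalerA mulrC.
Qed.

Definition sym_pr (d : int) : Sym -> Sym := plift (scalef_respects (fun e _ => (e == d)%:R)).

HB.instance Definition _ (d : int) :=
  GRing.isLinear.Build K _ _ _ (sym_pr d) (plift_is_linear (scalef_respects (fun e _ => (e == d)%:R))).

Lemma sym_prE d w : sym_pr d (wgen w) = if wdeg w == d then wgen w else 0.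
Proof.
by rewrite /sym_pr pliftE; case: eqP => _; rewrite ?scale1r ?scale0r.
Qed.

Lemma sym_gprK i j v :
  sym_pr i (sym_pr j v) = if i == j then sym_pr j v else 0.
Proof.
case: (eqVneq i j) => [->|ij].
  have e : (sym_pr j \o sym_pr j) =1 sym_pr j.
    apply: plin_ext => w.
    change (sym_pr j (sym_pr j (wgen w)) = sym_pr j (wgen w)).
    by rewrite sym_prE; case: ifP => h; rewrite ?linear0 // sym_prE h.
  exact: e.
have e : (sym_pr i \o sym_pr j) =1 \0.
  apply: plin_ext => w; change (sym_pr i (sym_pr j (wgen w)) = 0).
  rewrite sym_prE; case: eqP => [h|_]; last exact: linear0.
  by rewrite sym_prE h eq_sym (negPf ij).
exact: e.
Qed.

Lemma sym_gfin (x : Sym) :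
  exists2 s : seq int, uniq s & x = \sum_(i <- s) sym_pr i x.
Proof.
exists (undup [seq wdeg p.2 | p <- repr x]); first exact: undup_uniq.
set s := undup _; have us : uniq s by apply: undup_uniq.
have : {subset [seq wdeg p.2 | p <- repr x] <= s}.
  by move=> i; rewrite mem_undup.
rewrite [x in x = _]pres_sum.
under [in X in _ -> _ = X]eq_bigr do rewrite [x in sym_pr _ x]pres_sum.
clearbody s; elim: (repr x) => [_|p r IH sub].
  by rewrite big_nil big1 // => i _; rewrite linear0.
rewrite big_cons {1}IH => [|i ir]; last by apply: sub; rewrite inE ir orbT.
under [RHS]eq_bigr do rewrite linearP.
rewrite big_split /=; congr (_ + _).
have ps : wdeg p.2 \in s by apply: sub; rewrite inE eqxx.
rewrite (bigD1_seq (wdeg p.2)) //= -/(wgen p.2) sym_prE eqxx.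
rewrite big1 ?addr0 // => i ni.
by rewrite sym_prE eq_sym (negPf ni) scaler0.
Qed.

Definition gSym : graded K := @Graded K Sym sym_pr sym_gprK sym_gfin.

(* x |-> (-1)^(k |x|) x *)
Definition twist (k : int) : Sym -> Sym := plift (scalef_respects (fun e _ => (-1) ^ (k * e))).

HB.instance Definition _ (k : int) :=
  GRing.isLinear.Build K _ _ _ (twist k) (plift_is_linear (scalef_respects (fun e _ => (-1) ^ (k * e)))).

Lemma twistE k w : twist k (wgen w) = (-1) ^ (k * wdeg w) *: wgen w.
Proof. exact: pliftE. Qed.

(* The projection onto Sym^1 = V. *)
Definition letter_of (w : word) : V :=
  if w is [:: x] then gpr x.1 x.2 else 0.

Lemma letter_respects : respects sym_rel letter_of.
Proof.
apply: sym_respects => // w t wt.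
case: (eqVneq (size w) 1%N) => [|s1].
  case: wt => {w t} [i a u v [|//]|i v [|//]|//|x [|//] t].
  - by rewrite big_cons big_seq1 /= linearP scale1r.
  - by rewrite big_seq1 scale1r /= gprK eqxx.
  - by move=> /word_rel_neq0.
have e (w' : word) : size w' = size w -> letter_of w' = 0.
  by case: w' => [|y [|]] //= h; rewrite -h eqxx in s1.
rewrite e // big_seq big1 // => p /(word_rel_size wt) /e ->; exact: scaler0.
Qed.

Definition sym_proj : Sym -> V := plift letter_respects.

HB.instance Definition _ :=
  GRing.isLinear.Build K _ _ _ sym_proj (plift_is_linear letter_respects).

Lemma sym_projE w : sym_proj (wgen w) = letter_of w.
Proof. exact: pliftE. Qed.

(* The inclusion of V as Sym^1. *)
Definition gsupp (v : V) : seq int := s2val (cid2 (gfin v)).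

Definition sym_incl (v : V) : Sym := \sum_(i <- gsupp v) wgen [:: (i, v)].

Lemma wgen_lin i a u v w :
  wgen ((i, a *: u + v) :: w) = a *: wgen ((i, u) :: w) + wgen ((i, v) :: w).
Proof. by rewrite (wgen_rel (word_lin i a u v w)) big_cons big_seq1 scale1r. Qed.

Lemma wgen_hom i v w : wgen ((i, v) :: w) = wgen ((i, gpr i v) :: w).
Proof. by rewrite (wgen_rel (word_hom i v w)) big_seq1 scale1r. Qed.

Lemma wgen0 i w : wgen ((i, 0) :: w) = 0.
Proof.
have := wgen_lin i 1 0 0 w; rewrite !scale1r addr0 => /eqP.
by rewrite -subr_eq0 opprD addrA subrr sub0r oppr_eq0 => /eqP.
Qed.

Lemma gpr_notin s (v : V) i : v = \sum_(j <- s) gpr j v -> i \notin s ->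
  gpr i v = 0.
Proof.
move=> -> si; rewrite linear_sum big_seq big1 // => j js.
by rewrite gprK; case: eqP => // ij; rewrite ij js in si.
Qed.

Lemma sym_incl_on s (v : V) : uniq s ->
  (forall i, i \notin s -> gpr i v = 0) ->
  sym_incl v = \sum_(i <- s) wgen [:: (i, v)].
Proof.
rewrite /sym_incl /gsupp; case: cid2 => /= s0 us0 vE us vs.
have h0 i : gpr i v = 0 -> wgen [:: (i, v)] = 0.
  by move=> e; rewrite wgen_hom e wgen0.
rewrite (bigID (mem s)) /= [X in _ + X]big1 ?addr0; last first.
  by move=> i si; apply/h0/vs.
rewrite [RHS](bigID (mem s0)) /= [X in _ = _ + X]big1 ?addr0; last first.
  by move=> i si; apply/h0/(gpr_notin vE si).
rewrite -big_filter -[RHS]big_filter; apply: perm_big.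
apply: uniq_perm; rewrite ?filter_uniq // => i.
by rewrite !mem_filter andbC.
Qed.

Lemma sym_incl_linear : linear sym_incl.
Proof.
move=> a u v; set s := undup (gsupp u ++ gsupp v).
have us : uniq s by apply: undup_uniq.
have hu i : i \notin s -> gpr i u = 0.
  rewrite mem_undup mem_cat negb_or /gsupp => /andP[+ _].
  by case: cid2 => /= s0 _ uE; apply: gpr_notin.
have hv i : i \notin s -> gpr i v = 0.
  rewrite mem_undup mem_cat negb_or /gsupp => /andP[_].
  by case: cid2 => /= s0 _ uE; apply: gpr_notin.
rewrite (sym_incl_on us hu) (sym_incl_on us hv) (@sym_incl_on s) //.
  by rewrite scaler_sumr -big_split; apply: eq_bigr => i _; rewrite /= wgen_lin.
by move=> i si; rewrite linearP hu // hv // scaler0 addr0.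
Qed.

HB.instance Definition _ :=
  GRing.isLinear.Build K _ _ _ sym_incl sym_incl_linear.

(* The product \/ (the tests keep the convention that the empty word is 0).   *)
Definition wprod (w w' : word) : Sym :=
  if nilp w || nilp w' then 0 else wgen (w ++ w').

Lemma word_rel_catl w t w' : word_rel w t ->
  word_rel (w ++ w') [seq (p.1, p.2 ++ w') | p <- t].
Proof.
elim=> {w t} [i a u v w|i v w|i u j v w|x w t _ IH] /=; try by constructor.
by have := word_cons x IH; rewrite -!map_comp.
Qed.

Lemma word_rel_catr w t w' : word_rel w t ->
  word_rel (w' ++ w) [seq (p.1, w' ++ p.2) | p <- t].
Proof.
move=> wt; elim: w' => [|x w' IH] /=.
  by rewrite (_ : map _ _ = t) // -[RHS]map_id; apply: eq_map => -[].
by have := word_cons x IH; rewrite -!map_comp.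
Qed.

Lemma wprod_respr w : respects sym_rel (wprod w).
Proof.
apply: sym_respects => [|w' t wt]; first by rewrite /wprod orbT.
rewrite /wprod; case: (boolP (nilp w)) => /= [_|nw].
  by rewrite big1 // => p _; apply: scaler0.
have nt w'' : size w'' = size w' -> nilp w'' = false.
  by rewrite /nilp => ->; rewrite (negbTE (word_rel_neq0 wt)).
rewrite nt // (wgen_rel (word_rel_catr w wt)) big_map big_seq [RHS]big_seq.
by apply: eq_bigr => p pt; rewrite nt ?(word_rel_size wt pt).
Qed.

Definition lmulw (w : word) : Sym -> Sym := plift (wprod_respr w).

HB.instance Definition _ (w : word) :=
  GRing.isLinear.Build K _ _ _ (lmulw w) (plift_is_linear (wprod_respr w)).

Lemma lmulwE w w' : lmulw w (wgen w') = wprod w w'.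
Proof. exact: pliftE. Qed.

Lemma lmulw_resp (y : Sym) : respects sym_rel (lmulw^~ y).
Proof.
apply: sym_respects => [|w t wt].
  rewrite (pres_sum y) linear_sum big1 // => p _.
  by rewrite linearZ /= -/(wgen p.2) lmulwE /wprod scaler0.
rewrite (pres_sum y) linear_sum.
under [RHS]eq_bigr => p _ do rewrite (linear_sum (lmulw p.2)) scaler_sumr.
rewrite exchange_big /=; apply: eq_bigr => q _.
rewrite linearZ /= -/(wgen q.2) lmulwE.
under [RHS]eq_bigr => p _ do
  rewrite (linearZ_LR (lmulw p.2)) /= -/(wgen q.2) lmulwE scalerA mulrC -scalerA.
rewrite -scaler_sumr; congr (_ *: _); rewrite /wprod.
have nt w'' : size w'' = size w -> nilp w'' = false.
  by rewrite /nilp => ->; rewrite (negbTE (word_rel_neq0 wt)).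
rewrite nt //=; case: (boolP (nilp q.2)) => [nq|nq].
  by rewrite big1 // => p _; rewrite orbT scaler0.
rewrite (wgen_rel (word_rel_catl q.2 wt)) big_map big_seq [RHS]big_seq.
by apply: eq_bigr => p pt; rewrite nt ?(word_rel_size wt pt).
Qed.

Definition smul (x y : Sym) : Sym := plift (lmulw_resp y) x.

Lemma smulE w w' : smul (wgen w) (wgen w') = wprod w w'.
Proof. by rewrite /smul pliftE lmulwE. Qed.

Lemma smul_linl a x x' y : smul (a *: x + x') y = a *: smul x y + smul x' y.
Proof. exact: linearP. Qed.

Lemma smul_linr a x y y' : smul x (a *: y + y') = a *: smul x y + smul x y'.
Proof.
have sE z : smul x z = \sum_(p <- repr x) p.1 *: lmulw p.2 z.
  rewrite /smul {1}(pres_sum x) linear_sum; apply: eq_bigr => p _.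
  by rewrite linearZ /= pliftE.
rewrite !sE scaler_sumr -big_split; apply: eq_bigr => p _ /=.
by rewrite linearP scalerDr !scalerA mulrC.
Qed.

Lemma smul_respects :
  respects (@tensor_rel K Sym Sym) (fun p => smul p.1 p.2).
Proof.
move=> x t []{x t} a x y z; rewrite big_cons big_seq1 /= scale1r.
  exact: smul_linl.
exact: smul_linr.
Qed.

Definition sym_mul : tensor Sym Sym -> Sym := plift smul_respects.

HB.instance Definition _ :=
  GRing.isLinear.Build K _ _ _ sym_mul (plift_is_linear smul_respects).

(* The iterated product V^{(x) (n+1)} -> Sym^(n+1), v0 (x) ... (x) vn |->     *)
(* v0 \/ ... \/ vn.                                                           *)
Fixpoint vee (n : nat) : {linear tpow V n -> Sym} :=
  match n with
  | 0 => sym_incl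
  | n'.+1 => sym_mul \o tmap sym_incl (vee n')
  end.

(* All ways to split a word into two complementary subwords, each with the    *)
(* exponent of the Koszul sign of the corresponding unshuffle.                *)
Fixpoint unshuffles (w : word) : seq (int * (word * word)) :=
  if w is x :: w' then
    [seq (p.1, (x :: p.2.1, p.2.2)) | p <- unshuffles w'] ++
    [seq (p.1 + x.1 * wdeg p.2.1, (p.2.1, x :: p.2.2)) | p <- unshuffles w']
  else [:: (0, ([::], [::]))].

Definition usum (W : lmodType K) (phi : word -> word -> W) (w : word) : W :=
  \sum_(p <- unshuffles w) (-1) ^ p.1 *: phi p.2.1 p.2.2.

Lemma sgnD (a b : int) : (-1) ^ (a + b) = (-1) ^ a * (-1) ^ b :> K.
Proof. by rewrite exprzDr // unitfE oppr_eq0 oner_eq0. Qed.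

Lemma usum_cons (W : lmodType K) (phi : word -> word -> W) x w :
  usum phi (x :: w) =
    usum (fun l r => phi (x :: l) r) w +
    usum (fun l r => (-1) ^ (x.1 * wdeg l) *: phi l (x :: r)) w.
Proof.
rewrite /usum /= big_cat !big_map /=; congr (_ + _).
by apply: eq_bigr => p _; rewrite scalerA sgnD.
Qed.

Lemma eq_usum (W : lmodType K) (phi psi : word -> word -> W) w :
  (forall l r, phi l r = psi l r) -> usum phi w = usum psi w.
Proof. by move=> e; apply: eq_bigr => p _; rewrite e. Qed.

Lemma usum_lin (W : lmodType K) (phi psi : word -> word -> W) a w :
  usum (fun l r => a *: phi l r + psi l r) w = a *: usum phi w + usum psi w.
Proof.
rewrite /usum scaler_sumr -big_split; apply: eq_bigr => p _ /=.
by rewrite scalerDr !scalerA mulrC.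
Qed.

Lemma usumZ (W : lmodType K) (phi : word -> word -> W) a w :
  usum (fun l r => a *: phi l r) w = a *: usum phi w.
Proof.
rewrite /usum scaler_sumr; apply: eq_bigr => p _ /=.
by rewrite !scalerA mulrC.
Qed.

Lemma usumD (W : lmodType K) (phi psi : word -> word -> W) w :
  usum (fun l r => phi l r + psi l r) w = usum phi w + usum psi w.
Proof.
rewrite /usum -big_split; apply: eq_bigr => p _ /=.
by rewrite scalerDr.
Qed.

Definition word_respects (W : lmodType K) (f : word -> W) :=
  forall w t, word_rel w t -> f w = \sum_(p <- t) p.1 *: f p.2.

Lemma usum_respects (W : lmodType K) (phi : word -> word -> W) :
  (forall r, word_respects (phi^~ r)) -> (forall l, word_respects (phi l)) ->
  word_respects (usum phi).
Proof.
move=> hl hr w t wt; elim: wt phi hl hr => {w t}.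
- move=> i a u v w phi hl hr; rewrite big_cons big_seq1 scale1r /= !usum_cons.
  rewrite scalerDr addrACA -!usum_lin; congr (_ + _); apply: eq_usum => l r.
    by rewrite (hl _ _ _ (word_lin i a u v l)) big_cons big_seq1 scale1r.
  rewrite (hr _ _ _ (word_lin i a u v r)) big_cons big_seq1 scale1r /=.
  by rewrite scalerDr !scalerA mulrC.
- move=> i v w phi hl hr; rewrite big_seq1 scale1r /= !usum_cons.
  congr (_ + _); apply: eq_usum => l r.
    by rewrite (hl _ _ _ (word_hom i v l)) big_seq1 scale1r.
  by rewrite (hr _ _ _ (word_hom i v r)) big_seq1 scale1r.
- move=> i u j v w phi hl hr; rewrite big_seq1 /= !usum_cons /=.
  rewrite -!usumD -usumZ; apply: eq_usum => l r.
  rewrite (hl _ _ _ (word_swap i u j v l)) (hr _ _ _ (word_swap i u j v r)).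
  rewrite !big_seq1 /= !wdeg_cons /= !mulrDr !sgnD !scalerDr !scalerA.
  have ss : (-1) ^ (i * j) * (-1) ^ (i * j) = 1 :> K.
    by rewrite -expfzMl mulrNN mulr1 exp1rz.
  rewrite -!addrA; congr (_ + _); rewrite addrCA; congr (_ + _).
  congr (_ *: _ + _ *: _).
    by rewrite [j * i]mulrC mulrA ss mul1r.
  by rewrite mulrC [X in _ = _ * X]mulrC.
- move=> x w t wt IH phi hl hr; rewrite big_map /= usum_cons !IH.
  + rewrite -big_split; apply: eq_bigr => p _ /=.
    by rewrite usum_cons scalerDr.
  + move=> r w1 t1 w1t1; rewrite (hl _ _ _ w1t1) scaler_sumr.
    rewrite big_seq [RHS]big_seq; apply: eq_bigr => p pt.
    by rewrite (word_rel_deg w1t1 pt) !scalerA mulrC.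
  + move=> l w1 t1 w1t1; rewrite (hr _ _ _ (word_cons x w1t1)) big_map /=.
    rewrite scaler_sumr; apply: eq_bigr => p _.
    by rewrite !scalerA mulrC.
  + by move=> r w1 t1 w1t1; rewrite (hl _ _ _ (word_cons x w1t1)) big_map.
  + by move=> l w1 t1 w1t1; rewrite (hr _ _ _ w1t1).
Qed.

(* Since wgen [::] = 0, only the unshuffles with two nonempty parts count:    *)
(* this is the reduced coproduct.                                             *)
Definition wcoprod : word -> tensor Sym Sym :=
  usum (fun l r => tens (wgen l) (wgen r)).

Lemma tens0l (M N : lmodType K) (y : N) : tens (0 : M) y = 0.
Proof.
have := tens_linl 1 (0 : M) 0 y; rewrite !scale1r addr0 => /eqP.
by rewrite -subr_eq0 opprD addrA subrr sub0r oppr_eq0 => /eqP.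
Qed.

Lemma tens0r (M N : lmodType K) (x : M) : tens x (0 : N) = 0.
Proof.
have := tens_linr 1 x (0 : N) 0; rewrite !scale1r addr0 => /eqP.
by rewrite -subr_eq0 opprD addrA subrr sub0r oppr_eq0 => /eqP.
Qed.

Lemma wcoprod_respects : respects sym_rel wcoprod.
Proof.
apply: sym_respects.
  by rewrite /wcoprod /usum big_seq1 /= wgen_nil tens0l scaler0.
apply: usum_respects => [r|l] w t wt; rewrite (wgen_rel wt).
  elim: t {wt} => [|p t IH]; first by rewrite !big_nil tens0l.
  by rewrite !big_cons tens_linl IH.
elim: t {wt} => [|p t IH]; first by rewrite !big_nil tens0r.
by rewrite !big_cons tens_linr IH.
Qed.

Definition coprod : Sym -> tensor Sym Sym := plift wcoprod_respects.

HB.instance Definition _ :=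
  GRing.isLinear.Build K _ _ _ coprod (plift_is_linear wcoprod_respects).

(* [iter_coprod n] takes values in n + 1 tensor factors. *)
Fixpoint iter_coprod (n : nat) : {linear Sym -> tpow Sym n} :=
  match n with
  | 0 => idfun
  | n'.+1 => tmap idfun (iter_coprod n') \o coprod
  end.

(* f 0 (x) ... (x) f n, where f k has degree d k, with the Koszul sign        *)
(* (g (x) h) (x (x) y) = (-1)^(|h| |x|) g x (x) h y.                          *)
Fixpoint ctens (W : lmodType K) (n : nat) (f : nat -> {linear Sym -> W})
    (d : nat -> int) : {linear tpow Sym n -> tpow W n} :=
  match n with
  | 0 => f 0%N
  | n'.+1 => tmap (f 0%N \o twist (\sum_(j < n'.+1) d j.+1))
                  (ctens n' (fun k => f k.+1) (fun k => d k.+1))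
  end.

(* The filtration of Sym by length: [sym_lt m] is the span of Sym^n, n < m.   *)
Definition wspan (P : word -> Prop) (x : Sym) : Prop :=
  exists2 s : seq (K * word), (forall p, p \in s -> P p.2) &
    x = \sum_(p <- s) p.1 *: wgen p.2.

Definition sym_lt (m : nat) : Sym -> Prop :=
  wspan (fun w => (size w < m)%N).

(* The filtration of Sym induced by a filtration F of V. *)
Inductive wfil (F : int -> V -> Prop) : int -> word -> Prop :=
| wfil_nil : wfil F 0 [::]
| wfil_cons k l i v w : F k v -> wfil F l w -> wfil F (k + l) ((i, v) :: w).

Definition sym_fil (F : int -> V -> Prop) (k : int) : Sym -> Prop :=
  wspan (wfil F k).

End SymmetricCoalgebra.

Arguments iter_coprod {K V}.
Arguments vee {K V}.
Arguments coprod {K V}.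
Arguments sym_proj {K V}.
Arguments sym_incl {K V}.
Arguments twist {K V}.

Definition fil_compat (K : fieldType) (M N : lmodType K)
    (F : int -> M -> Prop) (G : int -> N -> Prop) (f : M -> N) : Prop :=
  forall k x, F k x -> G k (f x).

Lemma trivial_sym_fil (K : fieldType) (V : graded K) (k : int) (x : Sym V) :
  sym_fil (trivial_filtration V) k x <-> (0 < k -> x = 0).
Proof.
have w0 m w : wfil (trivial_filtration V) m w -> 0 < m ->
    forall w', wgen (w' ++ w) = 0.
  elim=> {m w} [//|m l i v w Fm _ IH ml w'].
  case: (ltrP 0 m) => [m0|m0].
    rewrite (Fm m0).
    have := wgen_rel (word_rel_catr w' (word_lin i (-1) 0 0 w)).
    by rewrite scaler0 addr0 big_map big_cons big_seq1 /= scaleN1r scale1r addNr.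
  have l0 : 0 < l by rewrite (lt_le_trans ml) // gerDr.
  by rewrite -cat_rcons IH.
split=> [[s hs ->] k0|hx].
  rewrite big_seq big1 // => p ps.
  by rewrite (w0 k p.2 (hs p ps) k0 [::]) scaler0.
case: (ltrP 0 k) => [/hx ->|k0]; first by exists [::]; rewrite ?big_nil.
exists [seq p <- repr x | p.2 != [::]] => [p|]; last first.
  rewrite {1}(pres_sum x) (bigID (fun p => p.2 == [::])) /=.
  rewrite [X in X + _]big1 ?add0r ?big_filter // => p /eqP ->.
  by rewrite -/(wgen _) wgen_nil scaler0.
rewrite mem_filter => /andP[+ _]; case: p.2 => [//|[i v] w _].
have F0 m u : m <= 0 -> trivial_filtration V m u.
  by move=> m0 m1; have := lt_le_trans m1 m0; rewrite ltxx.
rewrite -[k]addr0; apply: wfil_cons; first exact: F0.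
elim: w => [|[j u] w IH]; first exact: wfil_nil.
by rewrite -[0]addr0; apply: wfil_cons => //; apply: F0.
Qed.

(* In every record below the filtrations are part of the data; spaces without *)
(* filtration are those with the trivial filtration.                          *)
Record linf_algebra (K : fieldType) := LinfAlgebra {
  lspace :> graded K;
  lfil : filtration lspace;
  lQ : {linear Sym (shift1 lspace) -> Sym (shift1 lspace)};
  lQ_degree :
    @of_degree K (gSym (shift1 lspace)) (gSym (shift1 lspace)) 1 lQ;
  lQ_coder : forall x, coprod (lQ x) =
    tmap lQ idfun (coprod x) + tmap (twist 1) lQ (coprod x);
  lQ_square : forall x, lQ (lQ x) = 0;
  lQ_filtered : fil_compat (@sym_fil K (shift1 lspace) lfil)
                           (@sym_fil K (shift1 lspace) lfil) lQ
}.
Arguments lfil {K} l.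
Arguments lQ {K} l.

Record linf_morphism (K : fieldType) (L L' : linf_algebra K) := LinfMorphism {
  lmor :> {linear Sym (shift1 L) -> Sym (shift1 L')};
  lmor_degree : @of_degree K (gSym (shift1 L)) (gSym (shift1 L')) 0 lmor;
  lmor_coalg : forall x, coprod (lmor x) = tmap lmor lmor (coprod x);
  lmor_Q : forall x, lmor (lQ L x) = lQ L' (lmor x);
  lmor_filtered : fil_compat (@sym_fil K (shift1 L) (lfil L))
                             (@sym_fil K (shift1 L') (lfil L')) lmor
}.

Section Composition.
Variables (K : fieldType) (L L' L'' : linf_algebra K).
Variables (H : linf_morphism L' L'') (F : linf_morphism L L').

Lemma comp_degree :
  @of_degree K (gSym (shift1 L)) (gSym (shift1 L'')) 0 (lmor H \o lmor F).
Proof.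
move=> i v hv; have := lmor_degree H (lmor_degree F hv).
by rewrite /= !addr0.
Qed.

Lemma comp_coalg x : coprod ((lmor H \o lmor F) x) =
  tmap (lmor H \o lmor F) (lmor H \o lmor F) (coprod x).
Proof. by rewrite -tmap_comp -!lmor_coalg. Qed.

Lemma comp_Q x : (lmor H \o lmor F) (lQ L x) = lQ L'' ((lmor H \o lmor F) x).
Proof. by rewrite /= !lmor_Q. Qed.

Lemma comp_filtered :
  fil_compat (@sym_fil K (shift1 L) (lfil L))
             (@sym_fil K (shift1 L'') (lfil L'')) (lmor H \o lmor F).
Proof. by move=> k x hx; apply/lmor_filtered/lmor_filtered. Qed.

Definition linf_comp : linf_morphism L L'' :=
  LinfMorphism comp_degree comp_coalg comp_Q comp_filtered.

End Composition.

Section Convolution.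
Variables (K : fieldType) (L L' : linf_algebra K).

(* The elements of Hom(Sym(L[1]), L') are linear maps f : C -> V; those of    *)
(* degree k in H[1] are the f of degree k as maps Sym(L[1]) -> L'[1].         *)
Local Notation C := (Sym (shift1 L)).
Local Notation V := (shift1 L').

Definition conv_degree (k : int) (f : {linear C -> V}) : Prop :=
  @of_degree K (gSym (shift1 L)) V k f /\
  fil_compat (@sym_fil K (shift1 L) (lfil L)) (lfil L') f.

(* [convQ n f d] is the bracket of the n + 1 elements f 0, ..., f n of H,     *)
(* where f k has degree d k in H[1].                                          *)
Definition convQ (n : nat) (f : nat -> {linear C -> V}) (d : nat -> int) :
    C -> V :=
  if n is 0 then
    fun x => sym_proj (lQ L' (sym_incl (f 0%N x))) -
             (-1) ^ (d 0%N) *: f 0%N (lQ L x)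
  else
    fun x => sym_proj (lQ L' (vee n (ctens n f d (iter_coprod n x)))).

Definition conv_fil (m : nat) (g : C -> V) : Prop :=
  forall x, sym_lt m x -> g x = 0.

Definition conv_lim (u : nat -> C -> V) (g : C -> V) : Prop :=
  forall m, exists N, forall M, (N <= M)%N -> conv_fil m (fun x => g x - u M x).

(* Power series in t, given by their coefficients, that are polynomial modulo *)
(* each step of the filtration.                                               *)
Definition conv_series (k : int) (a : nat -> {linear C -> V}) : Prop :=
  (forall j, conv_degree k (a j)) /\
  (forall m, exists N, forall j, (N <= j)%N -> conv_fil m (a j)).

Definition conv_eval (t : K) (a : nat -> {linear C -> V}) (g : C -> V) : Prop :=
  conv_lim (fun N x => \sum_(j < N) t ^+ j *: a j x) g.

(* The coefficient of t^j in the bracket of lambda(t) and n copies of F(t).   *)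
Definition conv_flow (a l : nat -> {linear C -> V}) (n j : nat) (x : C) : V :=
  \sum_(i : (n.+1).-tuple 'I_j.+1 | (\sum_(k < n.+1) tnth i k)%N == j)
     convQ n (fun k => let ik := nth 0%N [seq val e | e <- i] k in
                       if k == 0%N then l ik else a ik)
             (fun k => if k == 0%N then -1 else 0) x.

(* An L-infinity morphism F is identified with the Maurer-Cartan element      *)
(* given by its components, which is sym_proj \o F.                           *)
Definition elementary_homotopy (F0 F1 : linf_morphism L L') : Prop :=
  exists a l : nat -> {linear C -> V},
    [/\ conv_series 0 a, conv_series (-1) l,
        forall j, conv_lim
          (fun N x => \sum_(n < N) (n`!%:R)^-1 *: conv_flow a l n j x)
          (fun x => j.+1%:R *: a j.+1 x),
        conv_eval 0 a (sym_proj \o F0) &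
        conv_eval 1 a (sym_proj \o F1)].

Definition homotopic : linf_morphism L L' -> linf_morphism L L' -> Prop :=
  clos_trans _ elementary_homotopy.

End Convolution.

(* Main.v *)
Require Import Defs.
From mathcomp Require Import all_boot all_order all_algebra.
From HB Require Import structures.
From mathcomp Require Import zify ring boolp.
From Stdlib Require Import Relation_Operators.

(** A homotopy of L-infinity morphisms is best seen on coalgebra maps, where
    composing with H is harmless.  A morphism is a coalgebra map
    Phi : Sym(L[1]) -> Sym(L'[1]) commuting with the codifferentials Q, Q', and
    its Maurer-Cartan element is its projection to L'[1].  Let a(t), l(t) be a
    homotopy, Phi(t) the path of coalgebra maps with projection a(t), and
    Lambda(t) the coderivation along Phi(t) with projection l(t); for the
    convolution product these are exp(a) and l . exp(a).  The right-hand side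
    of the flow equation is the projection of Q' Lambda + Lambda Q.  Once Phi
    commutes with the codifferentials, dPhi/dt and Q' Lambda + Lambda Q are two
    coderivations along Phi with the same projection, so
                        dPhi/dt = Q' Lambda + Lambda Q.
    Composing with H gives the same equation for H Phi and H Lambda, which are
    again a path of coalgebra maps and a coderivation along it, and projecting
    it to L''[1] gives the flow equation from HF0 to HF1.

    The path is built not as exp(a) but by integrating the displayed equation,
    coefficient by coefficient, from Phi_0 = F0 and
    (j + 1) Phi_{j+1} = Q' Lambda_j + Lambda_j Q ([mor_path]), where
    Lambda_j only depends on Phi_0, ..., Phi_j.  By induction Phi_{j+1} is
    comultiplicative ([coalg_path]), has projection a_{j+1} by the flow
    equation, and commutes with the codifferentials because
    Q' (Q' Lambda + Lambda Q) = Q' Lambda Q = (Q' Lambda + Lambda Q) Q.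

    Three facts carry the argument.
    - If Phi is comultiplicative, l . Phi is a coderivation along Phi
      ([coder_ext_coder]).  On words this is cocommutativity and
      coassociativity of unshuffles and the coproduct of a product v \/ y.
    - In characteristic 0 an element killed by the reduced coproduct and by the
      projection is 0 ([coprod_proj_inj]).  By induction on word length,
      coderivations along Phi are then determined by their projections
      ([coder_unique]), and the sum Phi(1) stabilizes on each word length, to
      the morphism F1 ([coalg_sum]).
    - The series of brackets in the flow equation is the projection of
      Q' Lambda + Lambda Q ([flow_sum]), because a coalgebra map is the
      convolution exponential of its projection ([exp_power]). *)

Set Implicit Arguments.
Unset Strict Implicit.
Unset Printing Implicit Defensive.

Import Order.TTheory GRing.Theory Num.Theory.
Local Open Scope ring_scope.

(** * Linear maps, signs and sums over unshuffles *)

Definition linmap (K : fieldType) (U V : lmodType K) (f : U -> V)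
    (fL : linear f) : {linear U -> V} :=
  HB.pack f (GRing.isLinear.Build K U V *:%R f fL).

Section Signs.
Variable K : fieldType.

Lemma sgnK (a : int) : (-1) ^ a * (-1) ^ a = 1 :> K.
Proof. by rewrite -expfzMl mulrNN mulr1 exp1rz. Qed.

Lemma sgnN (a : int) : (-1) ^ (- a) = (-1) ^ a :> K.
Proof.
have h : (-1) ^ (- a) * ((-1) ^ a * (-1) ^ a) = (-1) ^ a :> K.
  by rewrite mulrA -[X in X * _]sgnD addNr expr0z mul1r.
by rewrite -h sgnK mulr1.
Qed.

Lemma sgnN1 : (-1) ^ (- 1 : int) = - 1 :> K.
Proof. by rewrite sgnN expr1z. Qed.

End Signs.

Section Unshuffles.
Variables (K : fieldType) (V : graded K).
Implicit Types (w l r : word V) (W : lmodType K).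

Lemma unshuffles_size w p : p \in unshuffles w ->
  (size p.2.1 + size p.2.2 = size w)%N.
Proof.
elim: w p => [|x w IH] p /=; first by rewrite inE => /eqP ->.
by rewrite mem_cat => /orP[] /mapP[q /IH <- ->] /=; rewrite ?addnS.
Qed.

Lemma unshuffles_deg w p : p \in unshuffles w ->
  wdeg p.2.1 + wdeg p.2.2 = wdeg w.
Proof.
elim: w p => [|x w IH] p /=.
  by rewrite inE => /eqP -> /=; rewrite /wdeg big_nil addr0.
rewrite mem_cat wdeg_cons => /orP[] /mapP[q /IH <- ->] /=; rewrite wdeg_cons.
  by rewrite addrA.
by rewrite addrCA.
Qed.

Lemma eq_usum_in W (phi psi : word V -> word V -> W) w :
  (forall l r, (size l + size r = size w)%N -> wdeg l + wdeg r = wdeg w ->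
     phi l r = psi l r) -> usum phi w = usum psi w.
Proof.
move=> e; rewrite /usum big_seq [RHS]big_seq; apply: eq_bigr => p pw.
by rewrite e ?(unshuffles_size pw) ?(unshuffles_deg pw).
Qed.

Lemma usum_nil W (phi : word V -> word V -> W) : usum phi [::] = phi [::] [::].
Proof. by rewrite /usum big_seq1 /= expr0z scale1r. Qed.

Lemma usum0 W w : usum (fun _ _ : word V => 0 : W) w = 0.
Proof. by rewrite /usum big1 // => p _; rewrite scaler0. Qed.

Lemma linear_usum W W' (h : {linear W -> W'}) (phi : word V -> word V -> W) w :
  h (usum phi w) = usum (fun l r => h (phi l r)) w.
Proof. by rewrite /usum linear_sum; apply: eq_bigr => p _; rewrite linearZ. Qed.

Lemma usum_sum W (I : Type) (s : seq I) (P : pred I)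
    (phi : I -> word V -> word V -> W) w :
  usum (fun l r => \sum_(i <- s | P i) phi i l r) w
  = \sum_(i <- s | P i) usum (phi i) w.
Proof.
by rewrite /usum exchange_big; apply: eq_bigr => p _ /=; rewrite scaler_sumr.
Qed.

Lemma usum_lnil W (phi : word V -> W) w :
  usum (fun l r => if nilp l then phi r else 0) w = phi w.
Proof.
elim: w phi => [|x w IH] phi; first by rewrite usum_nil.
rewrite usum_cons /= usum0 add0r -[RHS](IH (fun r => phi (x :: r))).
apply: eq_usum => l r; case: nilP => [->|_]; last exact: scaler0.
by rewrite /wdeg big_nil mulr0 expr0z scale1r.
Qed.

Lemma usum_rnil W (phi : word V -> W) w :
  usum (fun l r => if nilp r then phi l else 0) w = phi w.
Proof.
elim: w phi => [|x w IH] phi; first by rewrite usum_nil.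
rewrite usum_cons /= (IH (fun l => phi (x :: l))) -[RHS]addr0; congr (_ + _).
by rewrite -[RHS](usum0 W w); apply: eq_usum => l r; rewrite scaler0.
Qed.

(** Graded cocommutativity of the coproduct: exchanging the two parts of an
    unshuffle costs the Koszul sign of moving one past the other. *)
Lemma usum_swap W (phi : word V -> word V -> W) w :
  usum phi w = usum (fun l r => (-1) ^ (wdeg l * wdeg r) *: phi r l) w.
Proof.
elim: w phi => [|x w IH] phi.
  by rewrite !usum_nil /wdeg big_nil mul0r expr0z scale1r.
rewrite !usum_cons addrC; congr (_ + _); rewrite IH; apply: eq_usum => l r.
  rewrite wdeg_cons scalerA -sgnD; congr ((-1) ^ _ *: _); ring.
rewrite wdeg_cons scalerA; congr (_ *: _).
by rewrite [_ * (_ + _)]mulrDr sgnD mulrA [_ * x.1]mulrC sgnK mul1r.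
Qed.

(** Coassociativity: both sides run over the splittings of w into three
    subwords. *)
Lemma usum_assoc W (phi : word V -> word V -> word V -> W) w :
  usum (fun l r => usum (fun l1 l2 => phi l1 l2 r) l) w =
  usum (fun l r => usum (fun r1 r2 => phi l r1 r2) r) w.
Proof.
elim: w phi => [|x w IH] phi; first by rewrite !usum_nil.
rewrite !usum_cons.
under eq_usum do rewrite usum_cons.
under [X in _ = _ + X]eq_usum do rewrite usum_cons scalerDr.
rewrite !usumD -!addrA (IH (fun l1 => phi (x :: l1))); congr (_ + _).
rewrite (IH (fun l1 l2 r => (-1) ^ (x.1 * wdeg l1) *: phi l1 (x :: l2) r)).
congr (_ + _); first by apply: eq_usum => l r; rewrite usumZ.
under [RHS]eq_usum => l r.
  rewrite -usumZ.
  under eq_usum do rewrite scalerA -sgnD -mulrDr.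
  over.
rewrite -(IH (fun l1 l2 r => (-1) ^ (x.1 * (wdeg l1 + wdeg l2)) *:
             phi l1 l2 (x :: r))).
apply: eq_usum => l r; rewrite -usumZ; apply: eq_usum_in => l1 l2 _ <- //.
Qed.

End Unshuffles.

(** * Linear maps on tensor products *)

Section Bilinear.
Variable K : fieldType.

Lemma tens_ext (M N W : lmodType K) (f g : {linear tensor M N -> W}) :
  (forall x y, f (tens x y) = g (tens x y)) -> f =1 g.
Proof. by move=> fg; apply: plin_ext => -[x y]; apply: fg. Qed.

Lemma tensDl (M N : lmodType K) (x x' : M) (y : N) :
  tens (x + x') y = tens x y + tens x' y.
Proof. by have := tens_linl 1 x x' y; rewrite !scale1r. Qed.

Lemma tensDr (M N : lmodType K) (x : M) (y y' : N) :
  tens x (y + y') = tens x y + tens x y'.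
Proof. by have := tens_linr 1 x y y'; rewrite !scale1r. Qed.

Lemma tensZl (M N : lmodType K) a (x : M) (y : N) :
  tens (a *: x) y = a *: tens x y.
Proof. by have := tens_linl a x 0 y; rewrite tens0l !addr0. Qed.

Lemma tensZr (M N : lmodType K) a (x : M) (y : N) :
  tens x (a *: y) = a *: tens x y.
Proof. by have := tens_linr a x y 0; rewrite tens0r !addr0. Qed.

Lemma tensNl (M N : lmodType K) (x : M) (y : N) : tens (- x) y = - tens x y.
Proof. by rewrite -!scaleN1r tensZl. Qed.

Lemma tens_suml (M N : lmodType K) I (s : seq I) P (f : I -> M) (y : N) :
  tens (\sum_(i <- s | P i) f i) y = \sum_(i <- s | P i) tens (f i) y.
Proof.
by apply: (big_morph (fun x => tens x y)) => [x x'|]; rewrite ?tensDl ?tens0l.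
Qed.

Lemma tens_sumr (M N : lmodType K) I (s : seq I) P (x : M) (f : I -> N) :
  tens x (\sum_(i <- s | P i) f i) = \sum_(i <- s | P i) tens x (f i).
Proof.
by apply: (big_morph (fun y => tens x y)) => [y y'|]; rewrite ?tensDr ?tens0r.
Qed.

Definition tensr (M N : lmodType K) (x : M) : {linear N -> tensor M N} :=
  linmap (fun a => tens_linr a x).

Definition tensl (M N : lmodType K) (y : N) : {linear M -> tensor M N} :=
  linmap (fun a x x' => tens_linl a x x' y).

End Bilinear.

Arguments tensr {K M N}.
Arguments tensl {K M N}.

Section LinearSums.
Variables (K : fieldType) (U V : lmodType K).

Lemma sum_linear n (F : nat -> {linear U -> V}) :
  linear (fun x => \sum_(i < n) F i x).
Proof.
move=> a x y; rewrite scaler_sumr -big_split.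
by apply: eq_bigr => i _; rewrite linearP.
Qed.

Definition lsum n (F : nat -> {linear U -> V}) : {linear U -> V} :=
  linmap (sum_linear n F).

End LinearSums.

Section TensorMaps.
Variables (K : fieldType) (M N M' N' : lmodType K).
Implicit Types (f : {linear M -> M'}) (g : {linear N -> N'}).

Lemma eq_tmap (f f' : {linear M -> M'}) (g g' : {linear N -> N'}) z :
  f =1 f' -> g =1 g' -> tmap f g z = tmap f' g' z.
Proof.
move=> ff gg; apply: (@tens_ext _ _ _ _ (tmap f g) (tmap f' g')) => x y /=.
by rewrite !tmapE ff gg.
Qed.

Lemma tmapDl (f f' : {linear M -> M'}) g z :
  tmap (f \+ f') g z = tmap f g z + tmap f' g z.
Proof.
apply: (@tens_ext _ _ _ _ (tmap (f \+ f') g) (tmap f g \+ tmap f' g)) => x y /=.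
by rewrite !tmapE tensDl.
Qed.

Lemma tmapDr f (g g' : {linear N -> N'}) z :
  tmap f (g \+ g') z = tmap f g z + tmap f g' z.
Proof.
apply: (@tens_ext _ _ _ _ (tmap f (g \+ g')) (tmap f g \+ tmap f g')) => x y /=.
by rewrite !tmapE tensDr.
Qed.

Lemma tmap_suml n (f : nat -> {linear M -> M'}) g z :
  tmap (lsum n f) g z = \sum_(i < n) tmap (f i) g z.
Proof.
apply: (@tens_ext _ _ _ _ (tmap (lsum n f) g) (lsum n (fun i => tmap (f i) g)))
  => x y /=.
by rewrite tmapE /= tens_suml; apply: eq_bigr => i _; rewrite tmapE.
Qed.

Lemma tmap_sumr n f (g : nat -> {linear N -> N'}) z :
  tmap f (lsum n g) z = \sum_(i < n) tmap f (g i) z.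
Proof.
apply: (@tens_ext _ _ _ _ (tmap f (lsum n g)) (lsum n (fun i => tmap f (g i))))
  => x y /=.
by rewrite tmapE /= tens_sumr; apply: eq_bigr => i _; rewrite tmapE.
Qed.

Lemma tmapZl c (f : {linear M -> M'}) (g : {linear N -> N'}) z :
  tmap (c \*: f) g z = c *: tmap f g z.
Proof.
apply: (@tens_ext _ _ _ _ (tmap (c \*: f) g) (c \*: tmap f g)) => x y /=.
by rewrite !tmapE tensZl.
Qed.

Lemma tmapZr c (f : {linear M -> M'}) (g : {linear N -> N'}) z :
  tmap f (c \*: g) z = c *: tmap f g z.
Proof.
apply: (@tens_ext _ _ _ _ (tmap f (c \*: g)) (c \*: tmap f g)) => x y /=.
by rewrite !tmapE tensZr.
Qed.

End TensorMaps.

(** * The symmetric coalgebra on its generators *)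

Section SymGenerators.
Variables (K : fieldType) (V : graded K).
Implicit Types (w l r : word V).

Lemma sym_ext (W : lmodType K) (f g : {linear Sym V -> W}) :
  (forall w, f (wgen w) = g (wgen w)) -> f =1 g.
Proof. exact: plin_ext. Qed.

Lemma sym_ind (P : Sym V -> Prop) : P 0 ->
  (forall a w x, P x -> P (a *: wgen w + x)) -> forall x, P x.
Proof.
move=> P0 PS x; rewrite (pres_sum x); elim: (repr x) => [|p s IH].
  by rewrite big_nil.
by rewrite big_cons; apply: PS.
Qed.

Lemma wgen_nilp w : nilp w -> wgen w = 0.
Proof. by move/nilP->; exact: wgen_nil. Qed.

Lemma coprod_wgen w :
  coprod (wgen w) = usum (fun l r => tens (wgen l) (wgen r)) w.
Proof. exact: pliftE. Qed.

Lemma tmap_coprod_wgen (M N : lmodType K) (f : {linear Sym V -> M})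
    (g : {linear Sym V -> N}) w :
  tmap f g (coprod (wgen w)) =
  usum (fun l r => tens (f (wgen l)) (g (wgen r))) w.
Proof.
rewrite coprod_wgen linear_usum; apply: eq_usum => l r; exact: tmapE.
Qed.

(** The coproduct is reduced, so the two parts of a word that contribute are
    strictly shorter: this is what makes inductions on word length work. *)
Lemma eq_tmap_coprod (M N : lmodType K) (f f' : {linear Sym V -> M})
    (g g' : {linear Sym V -> N}) w :
  (forall u, (size u < size w)%N -> f (wgen u) = f' (wgen u)) ->
  (forall u, (size u < size w)%N -> g (wgen u) = g' (wgen u)) ->
  tmap f g (coprod (wgen w)) = tmap f' g' (coprod (wgen w)).
Proof.
move=> ff gg; rewrite !tmap_coprod_wgen; apply: eq_usum_in => l r lr _.
case: (posnP (size l)) => [l0|l0].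
  by rewrite (@wgen_nilp l) ?linear0 ?tens0l // /nilp l0.
case: (posnP (size r)) => [r0|r0].
  by rewrite (@wgen_nilp r) ?linear0 ?tens0r // /nilp r0.
by rewrite ff ?gg //; lia.
Qed.

Lemma sym_mulE (x y : Sym V) : sym_mul (tens x y) = smul x y.
Proof. exact: pliftE. Qed.

Lemma homog_wgen w : @homog K (gSym V) (wdeg w) (wgen w).
Proof. by rewrite /homog /= sym_prE eqxx. Qed.

Lemma twist_homog k e (x : Sym V) : @homog K (gSym V) e x ->
  twist k x = (-1) ^ (k * e) *: x.
Proof.
move=> hx; rewrite -hx.
apply: (@sym_ext _ (twist k \o sym_pr e) ((-1) ^ (k * e) \*: sym_pr e)) => w.
rewrite /= sym_prE; case: eqP => [<-|_]; first by rewrite twistE.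
by rewrite linear0 scaler0.
Qed.

Lemma twist0 (x : Sym V) : twist 0 x = x.
Proof.
apply: (@sym_ext _ (twist 0) idfun) => w /=.
by rewrite twistE mul0r expr0z scale1r.
Qed.

Lemma twistK k (x : Sym V) : twist k (twist k x) = x.
Proof.
apply: (@sym_ext _ (twist k \o twist k) idfun) => w /=.
by rewrite !twistE linearZ /= twistE scalerA sgnK scale1r.
Qed.

Lemma twistN k (x : Sym V) : twist (- k) x = twist k x.
Proof.
apply: (@sym_ext _ (twist (- k)) (twist k)) => w /=.
by rewrite !twistE mulNr sgnN.
Qed.

Lemma sym_incl_homog e (v : V) : homog e v -> sym_incl v = wgen [:: (e, v)].
Proof.
move=> hv; rewrite (@sym_incl_on _ _ [:: e]) ?big_seq1 // => i.
by rewrite inE => ie; rewrite -hv gprK (negPf ie).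
Qed.

Lemma smul_incl_homog e (v : V) (y : Sym V) : homog e v ->
  smul (sym_incl v) y = lmulw [:: (e, v)] y.
Proof. by move=> hv; rewrite (sym_incl_homog hv) /smul pliftE. Qed.

Lemma smulr0 (x : Sym V) : smul x 0 = 0.
Proof. by rewrite -sym_mulE tens0r linear0. Qed.

Lemma smul0r (x : Sym V) : smul 0 x = 0.
Proof. by rewrite -sym_mulE tens0l linear0. Qed.

Lemma sym_proj_incl (v : V) : sym_proj (sym_incl v) = v.
Proof.
rewrite /sym_incl linear_sum /= /gsupp; case: cid2 => /= s _ vE.
by rewrite [RHS]vE; apply: eq_bigr => i _; rewrite sym_projE.
Qed.

(** Products of nonempty words have length at least 2. *)
Lemma sym_proj_mul (x y : Sym V) : sym_proj (smul x y) = 0.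
Proof.
apply: (@sym_ext _ (sym_proj \o plift (lmulw_resp y)) \0) => w /=.
rewrite -[plift _ _]/(smul _ _) /smul pliftE.
apply: (@sym_ext _ (sym_proj \o lmulw w) \0) => w' /=.
rewrite lmulwE /wprod; case: w w' => [|c w] [|c' w'] /=; rewrite ?linear0 //.
by rewrite sym_projE; case: w.
Qed.

End SymGenerators.

Section SymDegrees.
Variables (K : fieldType) (V V' : graded K).

Lemma twist_deg (f : {linear Sym V -> Sym V'}) d k :
  @of_degree K (gSym V) (gSym V') d f ->
  forall x, twist k (f x) = (-1) ^ (k * d) *: f (twist k x).
Proof.
move=> df.
apply: (@sym_ext _ _ _ (twist k \o f) ((-1) ^ (k * d) \*: (f \o twist k))).
move=> w /=.
rewrite twistE (twist_homog _ (df _ _ (homog_wgen w))) linearZ /= scalerA -sgnD.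
by congr ((-1) ^ _ *: _); rewrite mulrDr addrC.
Qed.

End SymDegrees.

(** * Convolution products *)

Section ConvolutionProducts.
Variables (K : fieldType) (V W : graded K).
Implicit Types (f : nat -> {linear Sym V -> W}) (w : word V).

(** The convolution product of the maps from a coalgebra to an algebra.  It
    carries no Koszul sign: it is only used with g of degree 0. *)
Definition star (f g : {linear Sym V -> Sym W}) (x : Sym V) : Sym W :=
  sym_mul (tmap f g (coprod x)).

Fact star_linear (f g : {linear Sym V -> Sym W}) : linear (star f g).
Proof. by move=> a x y; rewrite /star !linearP. Qed.

HB.instance Definition _ (f g : {linear Sym V -> Sym W}) :=
  GRing.isLinear.Build K _ _ _ (star f g) (star_linear f g).

Lemma starE (f g : {linear Sym V -> Sym W}) x :
  star f g x = sym_mul (tmap f g (coprod x)).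
Proof. by []. Qed.

Lemma star_wgen (f g : {linear Sym V -> Sym W}) w :
  star f g (wgen w) = usum (fun l r => smul (f (wgen l)) (g (wgen r))) w.
Proof.
rewrite starE tmap_coprod_wgen linear_usum; apply: eq_usum => l r.
exact: sym_mulE.
Qed.

Fixpoint convprod n f : {linear Sym V -> Sym W} :=
  if n is n'.+1 then star (sym_incl \o f 0%N) (convprod n' (fun k => f k.+1))
  else sym_incl \o f 0%N.

Lemma convprod0 f x : convprod 0 f x = sym_incl (f 0%N x). Proof. by []. Qed.

Lemma convprodS n f :
  convprod n.+1 f = star (sym_incl \o f 0%N) (convprod n (fun k => f k.+1)).
Proof. by []. Qed.

Lemma eq_star (f f' g g' : {linear Sym V -> Sym W}) :
  f =1 f' -> g =1 g' -> star f g =1 star f' g'.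
Proof.
move=> ff gg; apply: (@sym_ext _ _ _ (star f g) (star f' g')) => w /=.
by rewrite !star_wgen; apply: eq_usum => l r; rewrite ff gg.
Qed.

(** The brackets of the convolution algebra are iterated convolution products.
    The Koszul signs come from the degrees of all maps but the first, and these
    are 0. *)
Lemma vee_ctens n f d : (forall k, d k.+1 = 0) -> forall x,
  vee n (ctens n f d (iter_coprod n x)) = convprod n f x.
Proof.
elim: n f d => [|n IH] f d d0 x; first by [].
rewrite convprodS /= starE /= !tmap_comp; congr (sym_mul _).
apply: eq_tmap => y /=.
  by rewrite big1 ?twist0.
by rewrite IH // => k; apply: d0.
Qed.

Lemma convprod_short n f w : (size w <= n)%N -> convprod n f (wgen w) = 0.
Proof.
elim: n f w => [|n IH] f w sw.
  by rewrite wgen_nilp ?linear0 // /nilp -leqn0.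
rewrite convprodS /= star_wgen -[RHS](usum0 _ w); apply: eq_usum_in => l r lr _.
case: (posnP (size l)) => [l0|l0].
  by rewrite (@wgen_nilp _ _ l) ?linear0 ?smul0r // /nilp l0.
rewrite IH ?smulr0 //; lia.
Qed.

End ConvolutionProducts.

(** * The coalgebra is detected by the coproduct and the projection *)

Section Expansion.
Variables (K : fieldType) (V : graded K).
Implicit Types (w : word V) (x : Sym V).

(** Euler's formula: moving each letter of w to the front restores w up to the
    Koszul sign, once per letter.  The prefix u makes the induction work. *)
Lemma usum_letter w u :
  usum (fun l r => if size l == 1%N then wgen (u ++ l ++ r) else 0) w =
  (size w)%:R *: wgen (u ++ w).
Proof.
elim: w u => [|x w IH] u; first by rewrite usum_nil scale0r.
rewrite usum_cons /= (eq_usum (psi := fun l r => if nilp l then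
    wgen (u ++ x :: r) else 0)) => [|[|y l] r] //.
rewrite usum_lnil -[in RHS]natr1 scalerDl scale1r addrC; congr (_ + _).
rewrite -[u ++ x :: w]cat_rcons -IH; apply: eq_usum => -[|y [|z l]] r /=.
- exact: scaler0.
- rewrite cat_rcons; case: x y => i a [j b].
  rewrite (wgen_rel (word_rel_catr u (word_swap i a j b r))) big_map big_seq1 /=.
  by rewrite /wdeg big_seq1.
- exact: scaler0.
Qed.

Lemma sym_incl_proj w :
  sym_incl (sym_proj (wgen w)) = if size w == 1%N then wgen w else 0.
Proof.
rewrite sym_projE; case: w => [|[i v] [|y w]] /=; rewrite ?linear0 //.
rewrite [RHS]wgen_hom; apply: sym_incl_homog.
by rewrite /homog gprK eqxx.
Qed.

(** The words that survive the projection of all parts of an iterated coproduct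
    are cut into single letters, in (n + 1)! orders that all give w back. *)
Lemma convprod_proj_wgen n w :
  convprod n (fun _ => sym_proj) (wgen w) =
  if size w == n.+1 then (n.+1)`!%:R *: wgen w else 0.
Proof.
elim: n w => [|n IH] w.
  by rewrite convprod0 sym_incl_proj; case: eqP => _ //; rewrite scale1r.
rewrite convprodS /= star_wgen /=.
case: (eqVneq (size w) n.+2) => [sw|sw]; last first.
  rewrite -[RHS](usum0 _ w); apply: eq_usum_in => l r lr _.
  rewrite IH sym_incl_proj; case: eqP => [l1|_]; last exact: smul0r.
  by case: eqP => [r1|_]; [case/eqP: sw; lia|exact: smulr0].
rewrite factS mulnC natrM -scalerA -sw -(usum_letter w [::]) -usumZ.
apply: eq_usum_in => l r lr _; rewrite sym_incl_proj IH.
case: eqP => [l1|_]; last by rewrite smul0r scaler0.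
have -> : size r == n.+1 by apply/eqP; lia.
rewrite -sym_mulE tensZr linearZ /= sym_mulE smulE /wprod.
by rewrite /nilp l1 (_ : size r == 0%N = false) //; apply/eqP; lia.
Qed.

Hypothesis charK : [pchar K] =i pred0.

Lemma natr_neq0 n : n.+1%:R != 0 :> K.
Proof. by rewrite ((pcharf0P K).1 charK). Qed.

Lemma fact_neq0 n : n`!%:R != 0 :> K.
Proof. by rewrite ((pcharf0P K).1 charK) -lt0n fact_gt0. Qed.

(** The identity is the convolution exponential of the projection. *)
Lemma sym_exp_proj x : exists N, forall M, (N <= M)%N ->
  \sum_(n < M) ((n.+1)`!%:R)^-1 *: convprod n (fun _ => sym_proj) x = x.
Proof.
elim/sym_ind: x => [|a w x [N IH]].
  by exists 0%N => M _; rewrite big1 // => n _; rewrite linear0 scaler0.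
exists (maxn (size w) N) => M; rewrite geq_max => /andP[pM NM].
under eq_bigr do rewrite linearP scalerDr.
rewrite big_split /= IH //; congr (_ + _).
under eq_bigr => n _ do rewrite scalerA mulrC -scalerA convprod_proj_wgen.
rewrite -scaler_sumr; congr (_ *: _).
case: (posnP (size w)) => [p0|p0].
  rewrite big1 => [|n _]; last by rewrite p0 scaler0.
  by rewrite wgen_nilp // /nilp p0.
have lt : ((size w).-1 < M)%N by lia.
rewrite (bigD1 (Ordinal lt)) //= prednK // eqxx scalerA mulVf ?fact_neq0 //.
rewrite scale1r big1 ?addr0 // => n nn.
case: eqP => [e|_]; last exact: scaler0.
by case/eqP: nn; apply: val_inj; rewrite /= e.
Qed.

(** Every term of the exponential of the projection is computed from sym_proj x
    or from coprod x. *)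
Lemma coprod_proj_inj x : coprod x = 0 -> sym_proj x = 0 -> x = 0.
Proof.
move=> dx px; have [N /(_ N (leqnn N)) <-] := sym_exp_proj x.
rewrite big1 // => -[[|n] _] _ /=; first by rewrite px !linear0.
by rewrite starE dx !linear0.
Qed.

Lemma sym_eq_coprod_proj (x y : Sym V) :
  coprod x = coprod y -> sym_proj x = sym_proj y -> x = y.
Proof.
move=> dxy pxy; apply/eqP; rewrite -subr_eq0; apply/eqP.
by apply: coprod_proj_inj; rewrite linearB /= (dxy, pxy) subrr.
Qed.
End Expansion.

(** * The coproduct of a convolution product *)

Section CoproductOfProduct.
Variables (K : fieldType) (V : graded K).

Lemma tens_usuml (M N : lmodType K) (phi : word V -> word V -> M) w (y : N) :
  tens (usum phi w) y = usum (fun l r => tens (phi l r) y) w.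
Proof. exact: (linear_usum (tensl y)). Qed.

Lemma tens_usumr (M N : lmodType K) (x : M) (phi : word V -> word V -> N) w :
  tens x (usum phi w) = usum (fun l r => tens x (phi l r)) w.
Proof. exact: (linear_usum (tensr x)). Qed.

Lemma coprod_letter (x : int * V) : coprod (wgen [:: x]) = 0.
Proof.
by rewrite coprod_wgen usum_cons !usum_nil wgen_nil tens0r tens0l scaler0 addr0.
Qed.

Lemma coprod_incl (v : V) : coprod (sym_incl v) = 0.
Proof.
by rewrite /sym_incl linear_sum big1 //= => i _; rewrite coprod_letter.
Qed.

(** In the unreduced coalgebra this would be the multiplicativity
    Delta (x \/ y) = (x (x) 1 + 1 (x) x) Delta y.  The first two terms
    are those in which one part of Delta y is empty. *)
Lemma coprod_lmul (x : int * V) (y : Sym V) :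
  coprod (lmulw [:: x] y) =
    tens (wgen [:: x]) y + tens (twist x.1 y) (wgen [:: x]) +
    tmap (lmulw [:: x]) idfun (coprod y) +
    tmap (twist x.1) (lmulw [:: x]) (coprod y).
Proof.
move: y; apply: (@sym_ext _ _ _ (coprod \o lmulw [:: x])
  ((tensr (wgen [:: x]) \+ (tensl (wgen [:: x]) \o twist x.1)) \+
   (tmap (lmulw [:: x]) idfun \o coprod) \+
   (tmap (twist x.1) (lmulw [:: x]) \o coprod))) => w /=.
rewrite lmulwE !tmap_coprod_wgen /wprod /= twistE.
case: (boolP (nilp w)) => [nw|nw].
  rewrite (wgen_nilp nw) scaler0 tens0r tens0l linear0 !add0r.
  by case: w nw => [|//] _; rewrite !usum_nil wgen_nil !linear0 !tens0r addr0.
have splitl l : wgen (x :: l) =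
    (if nilp l then wgen [:: x] else 0) + lmulw [:: x] (wgen l).
  rewrite lmulwE /wprod /=; case: nilP => [->|_]; last by rewrite add0r.
  by rewrite addr0.
rewrite coprod_wgen usum_cons.
under eq_usum do rewrite splitl tensDl.
under [X in _ + X = _]eq_usum do rewrite splitl tensDr scalerDr.
rewrite !usumD.
have -> : usum (fun l r => tens (if nilp l then wgen [:: x] else 0) (wgen r)) w
    = tens (wgen [:: x]) (wgen w).
  rewrite -(usum_lnil (fun r => tens (wgen [:: x]) (wgen r))).
  by apply: eq_usum => l r; case: ifP; rewrite ?tens0l.
have -> : usum (fun l r => (-1) ^ (x.1 * wdeg l) *:
      tens (wgen l) (if nilp r then wgen [:: x] else 0)) w
    = tens ((-1) ^ (x.1 * wdeg w) *: wgen w) (wgen [:: x]).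
  rewrite -(usum_rnil (fun l => tens ((-1) ^ (x.1 * wdeg l) *: wgen l)
    (wgen [:: x]))).
  by apply: eq_usum => l r; case: ifP; rewrite ?tens0r ?scaler0 ?tensZl.
rewrite -!addrA; congr (_ + _); rewrite addrCA; congr (_ + (_ + _)).
by apply: eq_usum => l r; rewrite twistE tensZl.
Qed.

End CoproductOfProduct.

Section LeftProduct.
Variables (K : fieldType) (V W : graded K).
Variables (d : int) (f : {linear Sym V -> W}).
Variable Phi : nat -> {linear Sym V -> Sym W}.
Hypothesis f_degree : @of_degree K (gSym V) W d f.
Hypothesis Phi_degree : forall i, @of_degree K (gSym V) (gSym W) 0 (Phi i).

(** On a word w, the coproduct of f(l) \/ Phi(r) splits r again, by the
    comultiplicativity of Phi.  Coassociativity groups the three parts of w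
    when f(l) lies on the left of the tensor sign; when it lies on the right,
    the parts are first permuted, and moving f past Phi leaves the twist by
    the degree d of f. *)
Lemma coprod_star_incl j :
  (forall x, coprod (Phi j x) =
     \sum_(i < j.+1) tmap (Phi i) (Phi (j - i)%N) (coprod x)) ->
  forall x, coprod (star (sym_incl \o f) (Phi j) x) =
    tmap (sym_incl \o f) (Phi j) (coprod x) +
    tmap (Phi j \o twist d) (sym_incl \o f) (coprod x) +
    \sum_(i < j.+1)
      (tmap (star (sym_incl \o f) (Phi i)) (Phi (j - i)%N) (coprod x) +
       tmap (Phi i \o twist d) (star (sym_incl \o f) (Phi (j - i)%N)) (coprod x)).
Proof.
pose iF : {linear Sym V -> Sym W} := sym_incl \o f.
move=> dPhi.
apply: (@sym_ext _ _ _ (coprod \o star iF (Phi j))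
  ((tmap iF (Phi j) \o coprod) \+ (tmap (Phi j \o twist d) iF \o coprod) \+
   lsum j.+1 (fun i => (tmap (star iF (Phi i)) (Phi (j - i)%N) \o coprod) \+
     (tmap (Phi i \o twist d) (star iF (Phi (j - i)%N)) \o coprod)))) => w /=.
rewrite star_wgen linear_usum !tmap_coprod_wgen /=.
have split l r : coprod (smul (iF (wgen l)) (Phi j (wgen r))) =
    tens (iF (wgen l)) (Phi j (wgen r)) +
    (-1) ^ ((wdeg l + d) * wdeg r) *: tens (Phi j (wgen r)) (iF (wgen l)) +
    \sum_(i < j.+1)
      (usum (fun r1 r2 => tens (smul (iF (wgen l)) (Phi i (wgen r1)))
                               (Phi (j - i)%N (wgen r2))) r +
       usum (fun r1 r2 => (-1) ^ ((wdeg l + d) * wdeg r1) *: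
               tens (Phi i (wgen r1))
                    (smul (iF (wgen l)) (Phi (j - i)%N (wgen r2)))) r).
  have hl : homog (wdeg l + d) (f (wgen l)) := f_degree (homog_wgen l).
  have hP i u := @Phi_degree i _ _ (homog_wgen u).
  rewrite /iF /= (smul_incl_homog _ hl) coprod_lmul /= -(sym_incl_homog hl).
  rewrite (twist_homog _ (hP _ _)) addr0 tensZl -!addrA; congr (_ + (_ + _)).
  rewrite dPhi !linear_sum /= -big_split; apply: eq_bigr => i _ /=.
  rewrite tmap_coprod_wgen !linear_usum /=; congr (_ + _).
    by apply: eq_usum => r1 r2; rewrite tmapE /= (smul_incl_homog _ hl).
  apply: eq_usum => r1 r2; rewrite tmapE /= (smul_incl_homog _ hl).
  by rewrite (twist_homog _ (hP _ _)) addr0 tensZl.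
under eq_usum do rewrite split.
rewrite !usumD usum_sum; congr (_ + _ + _).
  rewrite usum_swap; apply: eq_usum => l r /=.
  rewrite twistE [Phi j (_ *: _)]linearZ /= tensZl.
  rewrite scalerA -sgnD; congr (_ *: _).
  by rewrite mulrDl [wdeg r * _]mulrC addrA sgnD sgnD sgnK mul1r.
apply: eq_bigr => i _; rewrite !tmap_coprod_wgen usumD; congr (_ + _).
  rewrite -(usum_assoc (fun l r1 r2 => tens (smul (iF (wgen l))
    (Phi i (wgen r1))) (Phi (j - i)%N (wgen r2)))).
  apply: eq_usum => l r /=.
  by rewrite star_wgen tens_usuml.
pose X l r1 r2 := (-1) ^ ((wdeg l + d) * wdeg r1) *: tens (Phi i (wgen r1))
    (smul (iF (wgen l)) (Phi (j - i)%N (wgen r2))).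
(* The letter f l has to be moved past Phi r1: permute the first two of the
   three parts of w. *)
rewrite -(usum_assoc X); under eq_usum do rewrite usum_swap.
rewrite (usum_assoc (fun l1 l2 r => (-1) ^ (wdeg l1 * wdeg l2) *: X l2 l1 r)).
apply: eq_usum => l r /=.
rewrite star_wgen tens_usumr.
apply: eq_usum => r1 r2 /=; rewrite twistE [Phi i (_ *: _)]linearZ /= tensZl.
rewrite /X scalerA -sgnD; congr (_ *: _).
by rewrite mulrDl [wdeg r1 * _]mulrC addrA sgnD sgnD sgnK mul1r.
Qed.

End LeftProduct.

(** * Sums over triangles *)

Section TriangularSums.
Variable M : nmodType.
Implicit Types (B : nat -> nat -> M).

Lemma sum_triangle n B :
  \sum_(m < n) \sum_(i < m.+1) B i (m - i)%N = \sum_(i < n) \sum_(k < n - i) B i k.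
Proof.
elim: n => [|n IH]; first by rewrite !big_ord0.
rewrite big_ord_recr /= IH [RHS]big_ord_recr /= subSnn big_ord1.
rewrite [X in _ + X = _]big_ord_recr /= subnn addrA; congr (_ + _).
rewrite -big_split; apply: eq_bigr => i _ /=.
by rewrite subSn ?big_ord_recr // ltnW.
Qed.

Lemma sum_rev n B :
  \sum_(i < n.+1) B i (n - i)%N = \sum_(i < n.+1) B (n - i)%N i.
Proof.
rewrite (reindex_inj rev_ord_inj); apply: eq_bigr => i _ /=.
by rewrite subSS subKn // -ltnS.
Qed.

Lemma sum_triangle_swap n B :
  \sum_(i < n) \sum_(k < n - i) B i k = \sum_(k < n) \sum_(i < n - k) B i k.
Proof.
rewrite -sum_triangle -(sum_triangle n (fun i k => B k i)).
by apply: eq_bigr => m _; exact: sum_rev.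
Qed.

Lemma sum_square n N B : (N + N <= n)%N ->
  (forall i k, (N <= i)%N || (N <= k)%N -> B i k = 0) ->
  \sum_(m < n) \sum_(i < m.+1) B i (m - i)%N = \sum_(i < N) \sum_(k < N) B i k.
Proof.
move=> nN B0; rewrite sum_triangle.
have trunc p (F : nat -> M) : (N <= p)%N ->
    (forall i, (N <= i)%N -> F i = 0) -> \sum_(i < p) F i = \sum_(i < N) F i.
  move=> Np F0; rewrite -(subnKC Np) big_split_ord /= [X in _ + X]big1 ?addr0 //.
  by move=> i _; apply: F0; apply: leq_addr.
rewrite (trunc _ (fun i => \sum_(k < n - i) B i k)) /=; last first.
- by move=> i Ni; rewrite big1 // => k _; rewrite B0 ?Ni.
- by apply: leq_trans nN; apply: leq_addr.
apply: eq_bigr => i _; apply: trunc => [|k Nk]; last by rewrite B0 ?Nk ?orbT.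
have := ltn_ord i; lia.
Qed.

End TriangularSums.

(** * Coderivations along a path of coalgebra maps *)

Section Coderivations.
Variables (K : fieldType) (V W : graded K).
Implicit Types (a l : nat -> {linear Sym V -> W}).
Implicit Types (Phi Psi : nat -> {linear Sym V -> Sym W}).

(** The coefficient of t^j in the equation saying that the power series
    Phi(t) is a coalgebra map. *)
Definition coalg_at Phi j := forall x : Sym V,
  coprod (Phi j x) = \sum_(i < j.+1) tmap (Phi i) (Phi (j - i)%N) (coprod x).

(** The coefficient of t^j in the equation saying that the power series Psi(t)
    is a coderivation of degree d along Phi(t). *)
Definition coder_at d Phi Psi j := forall x : Sym V,
  coprod (Psi j x) = \sum_(i < j.+1)
    (tmap (Psi i) (Phi (j - i)%N) (coprod x) +
     tmap (Phi i \o twist d) (Psi (j - i)%N) (coprod x)).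

(** The convolution product of l(t) and Phi(t), which is the coderivation along
    Phi(t) with projection l(t).  The first summand stands for the splittings
    of a word with an empty second part, on which a unital Phi(t) is 1. *)
Definition coder_ext l Phi j (x : Sym V) : Sym W :=
  sym_incl (l j x) + \sum_(i < j.+1) star (sym_incl \o l i) (Phi (j - i)%N) x.

Fact coder_ext_linear l Phi j : linear (coder_ext l Phi j).
Proof.
exact: (linearP ((sym_incl \o l j) \+
  lsum j.+1 (fun i => star (sym_incl \o l i) (Phi (j - i)%N)))).
Qed.

HB.instance Definition _ l Phi j :=
  GRing.isLinear.Build K _ _ _ (coder_ext l Phi j) (coder_ext_linear l Phi j).

Lemma proj_coder_ext l Phi j x : sym_proj (coder_ext l Phi j x) = l j x.
Proof.
rewrite /coder_ext linearD /= sym_proj_incl linear_sum big1 ?addr0 // => i _ /=.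
move: x; apply: (@sym_ext _ _ _ (sym_proj \o star (sym_incl \o l i)
  (Phi (j - i)%N)) \0) => w /=.
rewrite star_wgen linear_usum /= -[RHS](usum0 _ w); apply: eq_usum => u v.
exact: sym_proj_mul.
Qed.

(** [coprod_star_incl], summed over the coefficients of l: the double sums over
    the coefficients of l and of Phi run over the same triangles. *)
Lemma coder_ext_coder d l Phi j :
  (forall i, @of_degree K (gSym V) W d (l i)) ->
  (forall i, @of_degree K (gSym V) (gSym W) 0 (Phi i)) ->
  (forall i, (i <= j)%N -> coalg_at Phi i) ->
  coder_at d Phi (coder_ext l Phi) j.
Proof.
move=> dl dP cP x; rewrite /coder_ext linearD /= coprod_incl add0r linear_sum /=.
pose il i : {linear Sym V -> Sym W} := sym_incl \o l i.
pose sl i k : {linear Sym V -> Sym W} := star (il i) (Phi k).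
have extL i (g : {linear Sym V -> Sym W}) :
    tmap (coder_ext l Phi i) g (coprod x) = tmap (il i) g (coprod x) +
    \sum_(m < i.+1) tmap (sl m (i - m)%N) g (coprod x).
  rewrite -(tmap_suml _ (fun m => sl m (i - m)%N)) -tmapDl.
  exact: eq_tmap.
have extR i (g : {linear Sym V -> Sym W}) :
    tmap g (coder_ext l Phi i) (coprod x) = tmap g (il i) (coprod x) +
    \sum_(m < i.+1) tmap g (sl m (i - m)%N) (coprod x).
  rewrite -(tmap_sumr _ _ (fun m => sl m (i - m)%N)) -tmapDr.
  exact: eq_tmap.
under [RHS]eq_bigr => i _ do rewrite (extL i) (extR (j - i)%N).
pose X i k := tmap (sl i k) (Phi (j - i - k)%N) (coprod x).
pose Y i k := tmap (Phi k \o twist d) (sl i (j - i - k)%N) (coprod x).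
transitivity (\sum_(i < j.+1) tmap (il i) (Phi (j - i)%N) (coprod x) +
    \sum_(i < j.+1) tmap (Phi (j - i)%N \o twist d) (il i) (coprod x) +
    (\sum_(i < j.+1) \sum_(k < j.+1 - i) X i k +
     \sum_(i < j.+1) \sum_(k < j.+1 - i) Y i k)).
  rewrite -!big_split; apply: eq_bigr => i _ /=.
  rewrite (coprod_star_incl (dl i) dP); last by apply: cP; apply: leq_subr.
  by rewrite subSn -1?ltnS // big_split.
rewrite !big_split /= addrACA; congr (_ + _ + (_ + _)).
- by rewrite (sum_rev j (fun p q => tmap (Phi q \o twist d) (il p) (coprod x))).
- rewrite -(sum_triangle _ X); apply: eq_bigr => i _; apply: eq_bigr => m _.
  rewrite /X; have -> : (j - m - (i - m) = j - i)%N by have := ltn_ord m; lia.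
  by [].
rewrite sum_triangle_swap; apply: eq_bigr => k _; rewrite subSn -1?ltnS //.
by apply: eq_bigr => m _; rewrite /Y subnAC.
Qed.

Lemma eq_coder_ext l Phi (Phi' : nat -> {linear Sym V -> Sym W}) j :
  (forall i, (i <= j)%N -> Phi i =1 Phi' i) ->
  coder_ext l Phi j =1 coder_ext l Phi' j.
Proof.
move=> e x; rewrite /coder_ext; congr (_ + _); apply: eq_bigr => i _.
by apply: eq_star => // y; apply: e; apply: leq_subr.
Qed.

End Coderivations.

(** * Uniqueness of coalgebra maps and coderivations *)

Section Uniqueness.
Variables (K : fieldType) (V W : graded K).
Hypothesis charK : [pchar K] =i pred0.
Implicit Types (w : word V) (Phi Psi : nat -> {linear Sym V -> Sym W}).

(** By [sym_eq_coprod_proj] it is enough to compare the coproducts on a word,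
    and these only involve the values of Psi and Psi' on shorter words. *)
Lemma coder_unique d Phi Psi Psi' :
  (forall j, coder_at d Phi Psi j) -> (forall j, coder_at d Phi Psi' j) ->
  (forall j x, sym_proj (Psi j x) = sym_proj (Psi' j x)) ->
  forall j, Psi j =1 Psi' j.
Proof.
move=> cPsi cPsi' pP j; apply: sym_ext => w; move: j.
elim: {w}_.+1 {-2}w (ltnSn (size w)) => // n IH w wn j.
apply: (sym_eq_coprod_proj charK); last exact: pP.
rewrite (cPsi j) (cPsi' j); apply: eq_bigr => i _.
have short k u : (size u < size w)%N -> Psi k (wgen u) = Psi' k (wgen u).
  by move=> uw; apply: IH; apply: leq_trans uw wn.
by congr (_ + _); apply: eq_tmap_coprod => u uw //=; apply: short.
Qed.

(** If the series of the projections converges to the projection of a coalgebra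
    map F, then Phi(1) = F.  By induction on the word length: on words shorter
    than m the coefficients Phi_j vanish for j >= N, so on words of length m
    the triangle of the Phi_i (x) Phi_k with i + k < M contains the whole
    square i, k < N as soon as M >= 2 N, and the coproduct of the partial sum
    is that of F. *)
Lemma coalg_sum Phi (F : {linear Sym V -> Sym W}) :
  (forall j, coalg_at Phi j) ->
  (forall x, coprod (F x) = tmap F F (coprod x)) ->
  (forall m, exists N, forall M, (N <= M)%N -> forall w, (size w < m)%N ->
     \sum_(j < M) sym_proj (Phi j (wgen w)) = sym_proj (F (wgen w))) ->
  forall m, exists N, forall M, (N <= M)%N -> forall w, (size w < m)%N ->
     \sum_(j < M) Phi j (wgen w) = F (wgen w).
Proof.
move=> cP cF pP; elim=> [|m [N IH]]; first by exists 0%N.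
have [N' hN'] := pP m.+1.
have vanish j w : (N <= j)%N -> (size w < m)%N -> Phi j (wgen w) = 0.
  move=> Nj wm; have := IH j.+1 (leqW Nj) w wm.
  by rewrite big_ord_recr /= IH // => /(canRL (addKr _)); rewrite addNr.
exists (maxn (N + N) N') => M; rewrite geq_max => /andP[NM N'M] w wm.
apply: (sym_eq_coprod_proj charK); last by rewrite linear_sum /= hN'.
have short u : (size u < size w)%N -> (size u < m)%N by lia.
rewrite cF linear_sum /=; under eq_bigr => j _ do rewrite cP.
rewrite (sum_square (B := fun i k => tmap (Phi i) (Phi k) (coprod (wgen w))) NM).
  under eq_bigr => i _ do rewrite -tmap_sumr.
  rewrite -(tmap_suml _ Phi); apply: eq_tmap_coprod => u /short um /=;
    exact: IH.
move=> i k; rewrite tmap_coprod_wgen => Nik.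
rewrite -[RHS](usum0 _ w); have /orP[Ni|Nk] := Nik.
  rewrite -tmap_coprod_wgen (@eq_tmap_coprod _ _ _ _ _ \0 _ (Phi k)) //=.
    rewrite tmap_coprod_wgen; apply: eq_usum => l r; exact: tens0l.
  by move=> u /short; apply: vanish.
rewrite -tmap_coprod_wgen (@eq_tmap_coprod _ _ _ _ _ (Phi i) _ \0) //=.
  rewrite tmap_coprod_wgen; apply: eq_usum => l r; exact: tens0r.
by move=> u /short; apply: vanish.
Qed.

End Uniqueness.

(** * Powers of a series and the exponential formula *)

Section Compositions.
Implicit Types (n j : nat).

(** The sum of G over the sequences of n natural numbers with sum j, that is
    over the monomials contributing to t^j in a product of n power series. *)
Fixpoint csum (U : nmodType) n j (G : seq nat -> U) : U :=
  if n is n'.+1 then \sum_(i < j.+1) csum n' (j - i) (fun s => G (val i :: s))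
  else if j == 0%N then G [::] else 0.

Lemma eq_csum (U : nmodType) n j (G G' : seq nat -> U) :
  (forall s, G s = G' s) -> csum n j G = csum n j G'.
Proof.
elim: n j G G' => [|n IH] j G G' e /=; first by rewrite e.
by apply: eq_bigr => i _; apply: IH => s.
Qed.

Lemma csum_morph (U U' : nmodType) (h : U -> U') :
  h 0 = 0 -> {morph h : x y / x + y} ->
  forall n j G, h (csum n j G) = csum n j (fun s => h (G s)).
Proof.
move=> h0 hD; elim=> [|n IH] j G /=; first by case: ifP.
by rewrite (big_morph h hD h0); apply: eq_bigr => i _.
Qed.

Lemma csum0 (U : nmodType) n j : csum n j (fun _ => 0 : U) = 0.
Proof.
elim: n j => [|n IH] j /=; first by rewrite if_same.
by rewrite big1 // => i _.
Qed.

Lemma csum1 (U : nmodType) j (G : seq nat -> U) : csum 1 j G = G [:: j].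
Proof.
rewrite /= big_ord_recr /= subnn eqxx big1 ?add0r // => i _.
by rewrite subn_eq0 leqNgt ltn_ord.
Qed.

(** The sums over tuples bounded by any m > j are the same; only in this
    form, with m fixed and j decreasing, is the induction on n possible. *)
Lemma csum_tuple (U : nmodType) n j m (G : seq nat -> U) : (j < m)%N ->
  \sum_(i : n.-tuple 'I_m | (\sum_(k < n) tnth i k)%N == j)
     G [seq val e | e <- i] = csum n j G.
Proof.
elim: n j G => [|n IH] j G jm.
  rewrite /=; case: eqP => [->|j0].
    rewrite (big_pred1 [tuple]) // => t; rewrite big_ord0 (tuple0 t).
    exact: esym (eqxx _).
  by rewrite big_pred0 // => t; rewrite big_ord0; apply/eqP => /esym.
rewrite (reindex (fun p : 'I_m * n.-tuple 'I_m => cons_tuple p.1 p.2)) /=;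
  last first.
  exists (fun t : n.+1.-tuple 'I_m => (thead t, behead_tuple t)) => [[i t] _|t _].
    by congr (_, _); apply: val_inj.
  by rewrite [RHS]tuple_eta; apply: val_inj.
under eq_bigl => p.
  rewrite big_ord_recl tnth0; under eq_bigr do rewrite tnthS; over.
rewrite -(pair_big_dep xpredT
  (fun (i : 'I_m) (t : n.-tuple 'I_m) => (i + \sum_(k < n) tnth t k)%N == j)
  (fun (i : 'I_m) (t : n.-tuple 'I_m) => G (val i :: [seq val e | e <- t]))) /=.
rewrite (big_ord_widen m (fun i => csum n (j - i) (fun s => G (i :: s)))) //.
rewrite [RHS]big_mkcond; apply: eq_bigr => i _; case: ifP => ij.
  rewrite -IH; last by lia.
  by apply: eq_bigl => t; rewrite -[RHS](eqn_add2l i) subnKC.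
rewrite big_pred0 // => t; apply/negP => /eqP e; move/negP: ij; apply.
by rewrite ltnS -e leq_addr.
Qed.

End Compositions.

Section CompositionSums.
Variables (K : fieldType) (U V : lmodType K).

Fact csum_linear n j (g : seq nat -> {linear U -> V}) :
  linear (fun x => csum n j (fun s => g s x)).
Proof.
move=> c x y; elim: n j g => [|n IH] j g /=.
  by case: ifP => _; rewrite ?linearP // scaler0 addr0.
rewrite scaler_sumr -big_split; apply: eq_bigr => i _; exact: IH.
Qed.

Definition csuml n j (g : seq nat -> {linear U -> V}) : {linear U -> V} :=
  linmap (csum_linear n j g).

End CompositionSums.

Section ExponentialSeries.
Variables (K : fieldType) (V W : graded K).
Implicit Types (a l : nat -> {linear Sym V -> W}) (w : word V).
Implicit Types (Phi : nat -> {linear Sym V -> Sym W}).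

Lemma star_csuml n j (f : {linear Sym V -> Sym W})
    (g : seq nat -> {linear Sym V -> Sym W}) x :
  star f (csuml n j g) x = csum n j (fun s => star f (g s) x).
Proof.
rewrite /star -[RHS](csum_morph (linear0 _) (linearD (@sym_mul K W))).
congr (sym_mul _); move: (coprod x).
apply: (@tens_ext _ _ _ _ (tmap f (csuml n j g))
  (csuml n j (fun s => tmap f (g s)))) => y z /=.
rewrite tmapE [tens _ _](csum_morph (linear0 (tensr (f y)))
  (linearD (tensr (f y)))).
by apply: eq_csum => s; rewrite tmapE.
Qed.

(** The coefficient of t^j in the (n + 1)-st convolution power of a(t). *)
Definition power a n j (x : Sym V) : Sym W :=
  csum n.+1 j (fun s => convprod n (fun k => a (nth 0%N s k)) x).

HB.instance Definition _ a n j :=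
  GRing.isLinear.Build K _ _ _ (power a n j)
    (csum_linear n.+1 j (fun s => convprod n (fun k => a (nth 0%N s k)))).

Lemma powerE a n j x :
  power a n j x = csum n.+1 j (fun s => convprod n (fun k => a (nth 0%N s k)) x).
Proof. by []. Qed.

Lemma power0 a j x : power a 0 j x = sym_incl (a j x).
Proof. by rewrite powerE csum1. Qed.

Lemma star_power (f : {linear Sym V -> Sym W}) a n j x :
  star f (power a n j) x =
  csum n.+1 j (fun s => star f (convprod n (fun k => a (nth 0%N s k))) x).
Proof. by rewrite -star_csuml; apply: eq_star. Qed.

Lemma powerS a n j x :
  power a n.+1 j x = \sum_(i < j.+1) star (sym_incl \o a i) (power a n (j - i)) x.
Proof.
by rewrite powerE; apply: eq_bigr => i _; rewrite star_power.
Qed.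

Lemma power_short a n j w : (size w <= n)%N -> power a n j (wgen w) = 0.
Proof.
move=> wn; rewrite powerE -[RHS](csum0 _ n.+1 j); apply: eq_csum => s.
exact: convprod_short.
Qed.

(** Comultiplicativity of Phi moves an iterated coproduct from the target to
    the source, where the projections of Phi are the maps a. *)
Lemma power_convprod a Phi n j :
  (forall i, (i <= j)%N -> coalg_at Phi i) ->
  (forall i x, (i <= j)%N -> sym_proj (Phi i x) = a i x) ->
  forall x, power a n j x = convprod n (fun _ => sym_proj) (Phi j x).
Proof.
elim: n j => [|n IH] j cP pP x; first by rewrite power0 convprod0 /= pP.
rewrite powerS convprodS /= starE cP // [tmap _ _ (\sum_(_ < _) _)]linear_sum /=.
rewrite linear_sum; apply: eq_bigr => i _ /=.
rewrite starE tmap_comp; congr (sym_mul _); apply: eq_tmap => y /=.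
  by rewrite pP // -ltnS.
have le k : (k <= j - i -> k <= j)%N by move/leq_trans; apply; apply: leq_subr.
by apply: IH => [k /le|k z /le]; [apply: cP|apply: pP].
Qed.

Hypothesis charK : [pchar K] =i pred0.

(** A coalgebra map is the convolution exponential of its projection:
    [sym_exp_proj] in the target, pulled back along Phi.  The bound on N is
    explicit since powers beyond the length of w vanish. *)
Lemma exp_power a Phi j :
  (forall i, (i <= j)%N -> coalg_at Phi i) ->
  (forall i x, (i <= j)%N -> sym_proj (Phi i x) = a i x) ->
  forall w N, (size w <= N)%N ->
  \sum_(n < N) ((n.+1)`!%:R)^-1 *: power a n j (wgen w) = Phi j (wgen w).
Proof.
move=> cP pP w N wN.
have [M hM] := sym_exp_proj charK (Phi j (wgen w)).
rewrite -[RHS](hM (maxn M N) (leq_maxl _ _)).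
under [RHS]eq_bigr do rewrite -(power_convprod _ cP pP).
rewrite -(subnKC (leq_maxr M N)) big_split_ord /= [X in _ = _ + X]big1 ?addr0 //.
move=> i _; rewrite power_short ?scaler0 //.
by apply: leq_trans wN _; apply: leq_addr.
Qed.

(** The coefficient of t^j in the product of l(t) with n copies of a(t). *)
Definition mixed_power l a n j (x : Sym V) : Sym W :=
  csum n.+1 j (fun s => convprod n (fun k => let ik := nth 0%N s k in
                                if k == 0%N then l ik else a ik) x).

(** l . exp(a) = l . Phi; the factor 1/n! is that of the n-th power of a in the
    exponential, since l is one of the n + 1 factors. *)
Lemma mixed_power_sum l a Phi j :
  (forall i, (i <= j)%N -> coalg_at Phi i) ->
  (forall i x, (i <= j)%N -> sym_proj (Phi i x) = a i x) ->
  forall w N, (size w < N)%N ->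
  \sum_(n < N) (n`!%:R)^-1 *: mixed_power l a n j (wgen w) =
  coder_ext l Phi j (wgen w).
Proof.
move=> cP pP w [//|N] wN; rewrite big_ord_recl /=.
rewrite {1}/mixed_power csum1 convprod0 /= invr1 scale1r; congr (_ + _).
have mS n : mixed_power l a n.+1 j (wgen w) =
    \sum_(i < j.+1) star (sym_incl \o l i) (power a n (j - i)) (wgen w).
  by apply: eq_bigr => i _; rewrite star_power.
under eq_bigr => n _ do rewrite mS scaler_sumr.
rewrite exchange_big; apply: eq_bigr => i _ /=.
rewrite star_wgen; under eq_bigr => n _ do rewrite star_wgen -usumZ.
rewrite -usum_sum; apply: eq_usum_in => u v uv _.
have le k : (k <= j - i -> k <= j)%N by move/leq_trans; apply; apply: leq_subr.
rewrite -(@exp_power a Phi (j - i) _ _ v N); last by lia.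
- rewrite -sym_mulE tens_sumr linear_sum; apply: eq_bigr => n _.
  by rewrite tensZr linearZ /= sym_mulE.
- by move=> k /le; apply: cP.
by move=> k z /le; apply: pP.
Qed.

End ExponentialSeries.

(** * Degrees and filtrations *)

Section Homogeneity.
Variables (K : fieldType).

Lemma homog_lin (V : graded K) i a (u v : V) :
  homog i u -> homog i v -> homog i (a *: u + v).
Proof. by rewrite /homog linearP => -> ->. Qed.

Lemma homog0 (V : graded K) i : homog i (0 : V).
Proof. exact: linear0. Qed.

Lemma homogD (V : graded K) i (u v : V) :
  homog i u -> homog i v -> homog i (u + v).
Proof. by move=> hu hv; rewrite -[u]scale1r; apply: homog_lin. Qed.

Lemma homogZ (V : graded K) i a (u : V) : homog i u -> homog i (a *: u).
Proof. by rewrite /homog linearZ /= => ->. Qed.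

Lemma homog_sum (V : graded K) i (I : eqType) (s : seq I) (f : I -> V) :
  (forall p, p \in s -> homog i (f p)) -> homog i (\sum_(p <- s) f p).
Proof.
move=> h; rewrite big_seq; apply: (big_ind (fun x : V => homog i x)) => //.
- exact: homog0.
- by move=> u v; apply: homogD.
Qed.

Variables (V W : graded K).

Lemma of_degree_words d (f : {linear Sym V -> W}) :
  (forall w, homog (wdeg w + d) (f (wgen w))) -> @of_degree K (gSym V) W d f.
Proof.
move=> h i v; rewrite /homog /= => <-.
apply: (@sym_ext _ _ _ (gpr (i + d) \o (f \o sym_pr i)) (f \o sym_pr i)) => w /=.
by rewrite sym_prE; case: eqP => [<-|_]; [exact: h|rewrite !linear0].
Qed.

End Homogeneity.

Section Degrees.
Variables (K : fieldType) (V W : graded K).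

Lemma homog_incl e (v : W) : homog e v -> @homog K (gSym W) e (sym_incl v).
Proof.
move=> /sym_incl_homog ->; have := homog_wgen [:: (e, v)].
by rewrite wdeg_cons /wdeg big_nil addr0.
Qed.

(** A product with a homogeneous letter is a map given on words, which reduces
    the claim to [of_degree_words]. *)
Lemma homog_smul_incl e k (v : W) (y : Sym W) : homog e v ->
  @homog K (gSym W) k y -> @homog K (gSym W) (e + k) (smul (sym_incl v) y).
Proof.
move=> hv hy; rewrite (smul_incl_homog _ hv) addrC.
suff dm : @of_degree K (gSym W) (gSym W) e (lmulw [:: (e, v)]) by exact: dm.
apply: of_degree_words => w; rewrite /= lmulwE /wprod /=.
case: ifP => _; first exact: homog0.
by have := homog_wgen ((e, v) :: w); rewrite wdeg_cons addrC.
Qed.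

Lemma degree_coder_ext d (l : nat -> {linear Sym V -> W})
    (Phi : nat -> {linear Sym V -> Sym W}) j :
  (forall i, @of_degree K (gSym V) W d (l i)) ->
  (forall i, @of_degree K (gSym V) (gSym W) 0 (Phi i)) ->
  @of_degree K (gSym V) (gSym W) d (coder_ext l Phi j).
Proof.
move=> dl dP; apply: of_degree_words => w.
apply: homogD; first by apply: homog_incl; apply: dl; apply: homog_wgen.
apply: homog_sum => i _; rewrite star_wgen /usum; apply: homog_sum => p pw.
apply: homogZ; rewrite -(unshuffles_deg pw) addrAC.
apply: homog_smul_incl; first by apply: dl; apply: homog_wgen.
by rewrite -[wdeg _]addr0; apply: dP; apply: homog_wgen.
Qed.

Lemma degree_proj : @of_degree K (gSym V) V 0 sym_proj.
Proof.
apply: of_degree_words => w; rewrite /= sym_projE addr0.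
case: w => [|[i v] [|y w]] /=; try exact: homog0.
by rewrite wdeg_cons /wdeg big_nil addr0 /homog gprK eqxx.
Qed.

End Degrees.

Section Filtrations.
Variable K : fieldType.

Lemma wspan0 (V : graded K) (P : word V -> Prop) : wspan P 0.
Proof. by exists [::]; rewrite ?big_nil. Qed.

Lemma wspan_lin (V : graded K) (P : word V -> Prop) a x y :
  wspan P x -> wspan P y -> wspan P (a *: x + y).
Proof.
move=> [s Ps ->] [t Pt ->]; exists (fscale a s ++ t) => [p|].
  by rewrite mem_cat => /orP[/mapP[q qs ->]|]; [exact: (Ps q)|apply: Pt].
by rewrite big_cat sum_fscale.
Qed.

Lemma wspan_wgen (V : graded K) (P : word V -> Prop) w : P w -> wspan P (wgen w).
Proof.
move=> Pw; exists [:: (1, w)] => [p|]; first by rewrite inE => /eqP ->.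
by rewrite big_seq1 scale1r.
Qed.

Lemma wspan_ind (V : graded K) (M : lmodType K) (P : word V -> Prop)
    (Q : M -> Prop) (f : {linear Sym V -> M}) :
  Q 0 -> (forall a x y, Q x -> Q y -> Q (a *: x + y)) ->
  (forall w, P w -> Q (f (wgen w))) -> forall x, wspan P x -> Q (f x).
Proof.
move=> Q0 QL Qw x [s Ps ->]; elim: s Ps => [|p s IH] Ps.
  by rewrite big_nil linear0.
rewrite big_cons linearP; apply: QL; first by apply/Qw/Ps/mem_head.
by apply: IH => q qs; apply: Ps; rewrite inE qs orbT.
Qed.

Lemma wspan_sum (V : graded K) (P : word V -> Prop) I (s : seq I) (f : I -> Sym V) :
  (forall i, wspan P (f i)) -> wspan P (\sum_(i <- s) f i).
Proof.
move=> h; apply: (big_ind (wspan P)) => // [|x y hx hy]; first exact: wspan0.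
by rewrite -[x]scale1r; apply: wspan_lin.
Qed.

Section WordFiltration.
Variables (V : graded K) (F : int -> V -> Prop).

Lemma wfil_nilE k : wfil F k [::] -> k = 0.
Proof. by move=> h; inversion h. Qed.

Lemma wfil_consE k i v w : wfil F k ((i, v) :: w) ->
  exists k1 k2, [/\ k = k1 + k2, F k1 v & wfil F k2 w].
Proof. by move=> h; inversion h; subst; exists k0, l. Qed.

Lemma wfil_cat k1 k2 w1 w2 :
  wfil F k1 w1 -> wfil F k2 w2 -> wfil F (k1 + k2) (w1 ++ w2).
Proof.
elim=> [|k l i v w Fv _ IH] h2; first by rewrite add0r.
by rewrite -addrA; apply: wfil_cons => //; apply: IH.
Qed.

Lemma wfil_unshuffles k w p : wfil F k w -> p \in unshuffles w ->
  exists k1 k2, [/\ k = k1 + k2, wfil F k1 p.2.1 & wfil F k2 p.2.2].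
Proof.
move=> h; elim: h p => [|k1 k2 i v w' Fv _ IH] p.
  by rewrite inE => /eqP -> /=; exists 0, 0; split; constructor.
rewrite mem_cat => /orP[] /mapP[q /IH[q1 [q2 [-> h1 h2]]] ->] /=.
  by exists (k1 + q1), q2; rewrite addrA; split=> //; apply: wfil_cons.
by exists q1, (k1 + q2); rewrite addrCA; split=> //; apply: wfil_cons.
Qed.

Lemma fil_incl k v : F k v -> sym_fil F k (sym_incl v).
Proof.
move=> Fv; apply: wspan_sum => i; apply: wspan_wgen.
by rewrite -[k]addr0; apply: wfil_cons => //; constructor.
Qed.

Lemma fil_smul k1 k2 x y :
  sym_fil F k1 x -> sym_fil F k2 y -> sym_fil F (k1 + k2) (smul x y).
Proof.
move=> hx hy.
apply: (wspan_ind (Q := sym_fil F (k1 + k2)) (f := plift (lmulw_resp y))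
  (wspan0 _) (@wspan_lin _ _) _ hx) => w1 h1.
rewrite /= pliftE.
apply: (wspan_ind (Q := sym_fil F (k1 + k2)) (f := lmulw w1)
  (wspan0 _) (@wspan_lin _ _) _ hy) => w2 h2.
rewrite /= lmulwE /wprod; case: ifP => _; first exact: wspan0.
by apply: wspan_wgen; apply: wfil_cat.
Qed.

Hypothesis Fsub : filtered_sub F.

Lemma fil_proj : fil_compat (sym_fil F) F sym_proj.
Proof.
have [F0 FL Fgpr] := Fsub; move=> k x.
apply: (wspan_ind (Q := F k) (f := sym_proj)) => //.
  by move=> a u v; apply: FL.
move=> [|[i v] [|y w]] h; rewrite /= sym_projE /=; try exact: F0.
have [k1 [k2 [-> Fv /wfil_nilE ->]]] := wfil_consE h.
by rewrite addr0; apply: Fgpr.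
Qed.

End WordFiltration.

Section StarFiltration.
Variables (V W : graded K) (F : int -> V -> Prop) (G : int -> W -> Prop).

Lemma fil_compat_words (f : {linear Sym V -> Sym W}) :
  (forall k w, wfil F k w -> sym_fil G k (f (wgen w))) ->
  fil_compat (sym_fil F) (sym_fil G) f.
Proof.
move=> h k x; apply: (wspan_ind (f := f)) => [|a u v|]; first exact: wspan0.
  exact: wspan_lin.
exact: h.
Qed.

Lemma fil_star (f g : {linear Sym V -> Sym W}) :
  fil_compat (sym_fil F) (sym_fil G) f -> fil_compat (sym_fil F) (sym_fil G) g ->
  fil_compat (sym_fil F) (sym_fil G) (star f g).
Proof.
move=> hf hg; apply: fil_compat_words => k w hw; rewrite /= star_wgen /usum.
rewrite big_seq; apply: (big_ind (sym_fil G k)) => [|x y hx hy|p pw].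
- exact: wspan0.
- by rewrite -[x]scale1r; apply: wspan_lin.
have [k1 [k2 [-> h1 h2]]] := wfil_unshuffles hw pw.
rewrite -[X in sym_fil _ _ X]addr0; apply: wspan_lin; last exact: wspan0.
by apply: fil_smul; [apply: hf|apply: hg]; apply: wspan_wgen.
Qed.

Lemma fil_coder_ext (l : nat -> {linear Sym V -> W})
    (Phi : nat -> {linear Sym V -> Sym W}) j :
  (forall i, fil_compat (sym_fil F) G (l i)) ->
  (forall i, fil_compat (sym_fil F) (sym_fil G) (Phi i)) ->
  fil_compat (sym_fil F) (sym_fil G) (coder_ext l Phi j).
Proof.
move=> hl hP k x hx; rewrite /coder_ext -[X in X + _]scale1r; apply: wspan_lin.
  by apply: fil_incl; apply: hl.
apply: wspan_sum => i; apply: fil_star hx; last exact: hP.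
by move=> m y hy; apply: fil_incl; apply: hl.
Qed.

End StarFiltration.
End Filtrations.

(** * The flow equation *)

Section Flow.
Variables (K : fieldType) (L L' : linf_algebra K).
Local Notation C := (Sym (shift1 L)).
Local Notation C' := (Sym (shift1 L')).
Local Notation V' := (shift1 L').
Hypothesis charK : [pchar K] =i pred0.
Implicit Types (a l : nat -> {linear C -> V'}) (Phi : nat -> {linear C -> C'}).

Lemma conv_flow0 a l j x :
  conv_flow a l 0 j x =
  sym_proj (lQ L' (mixed_power l a 0 j x)) + l j (lQ L x).
Proof.
rewrite /conv_flow (@csum_tuple _ _ _ _ (fun s => convQ 0
  (fun k => let ik := nth 0%N s k in if k == 0%N then l ik else a ik)
  (fun k => if k == 0%N then -1 else 0) x)) ?ltnS //.
by rewrite csum1 /mixed_power csum1 /= sgnN1 scaleN1r opprK.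
Qed.

Lemma conv_flowS a l n j x :
  conv_flow a l n.+1 j x = sym_proj (lQ L' (mixed_power l a n.+1 j x)).
Proof.
rewrite /conv_flow (@csum_tuple _ _ _ _ (fun s => convQ n.+1
  (fun k => let ik := nth 0%N s k in if k == 0%N then l ik else a ik)
  (fun k => if k == 0%N then -1 else 0) x)) ?ltnS //.
symmetry; rewrite /mixed_power.
pose h : {linear C' -> V'} := sym_proj \o lQ L'.
apply: (etrans (csum_morph (linear0 h) (linearD h) _ _ _)); apply: eq_csum => s.
by rewrite /convQ vee_ctens.
Qed.

(** The bracket of a single map is the only one involving Q; all others, and
    its remaining part, add up to the projection of Q' applied to the
    exponential series of [mixed_power_sum]. *)
Lemma flow_sum a l Phi j :
  (forall i, (i <= j)%N -> coalg_at Phi i) ->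
  (forall i x, (i <= j)%N -> sym_proj (Phi i x) = a i x) ->
  forall N x, sym_lt N.+1 x ->
  \sum_(n < N.+1) (n`!%:R)^-1 *: conv_flow a l n j x =
  sym_proj (lQ L' (coder_ext l Phi j x)) + l j (lQ L x).
Proof.
move=> cP pP N x hx.
have e : \sum_(n < N.+1) (n`!%:R)^-1 *: mixed_power l a n j x =
    coder_ext l Phi j x.
  pose mp n : {linear C -> C'} := linmap (csum_linear n.+1 j (fun s =>
    convprod n (fun k => let ik := nth 0%N s k in if k == 0%N then l ik else a ik))).
  apply/eqP; rewrite -subr_eq0; apply/eqP.
  apply: (wspan_ind (Q := fun y => y = 0)
    (f := lsum N.+1 (fun n => (n`!%:R)^-1 \*: mp n) \- coder_ext l Phi j)
    _ _ _ hx) => //.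
    by move=> c y z -> ->; rewrite scaler0 addr0.
  move=> w wN /=; apply/eqP; rewrite subr_eq0; apply/eqP.
  exact: (mixed_power_sum charK l cP pP wN).
rewrite -e !linear_sum big_ord_recl [in RHS]big_ord_recl /= conv_flow0.
rewrite invr1 !scale1r addrAC; congr (_ + _ + _).
by apply: eq_bigr => n _; rewrite conv_flowS !linearZ.
Qed.

Lemma conv_limP (u : nat -> C -> V') (g : C -> V') m :
  conv_lim u g -> exists N, forall M, (N <= M)%N -> forall x, sym_lt m x ->
  u M x = g x.
Proof.
move=> /(_ m)[N hN]; exists N => M NM x hx; have /eqP := hN M NM x hx.
by rewrite subr_eq0 => /eqP.
Qed.

Lemma sym_lt_wgen m (w : word (shift1 L)) : (size w < m)%N -> sym_lt m (wgen w).
Proof. exact: wspan_wgen. Qed.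

(** The convergence of the series of brackets is an exact identity, because the
    series is finite on words of bounded length. *)
Lemma flow_coder_ext a l Phi j :
  (forall i, (i <= j)%N -> coalg_at Phi i) ->
  (forall i x, (i <= j)%N -> sym_proj (Phi i x) = a i x) ->
  conv_lim (fun N x => \sum_(n < N) (n`!%:R)^-1 *: conv_flow a l n j x)
           (fun x => j.+1%:R *: a j.+1 x) <->
  forall x, j.+1%:R *: a j.+1 x =
            sym_proj (lQ L' (coder_ext l Phi j x)) + l j (lQ L x).
Proof.
move=> cP pP; split=> [lim|e m]; last first.
  exists m.+1 => -[//|M] mM x hx; rewrite (@flow_sum a l Phi j cP pP) ?e ?subrr //.
  case: hx => s hs ->; exists s => // p ps; apply: leq_trans (hs p ps) _.
  exact: ltnW.
apply: (@sym_ext _ _ _ (j.+1%:R \*: a j.+1)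
  ((sym_proj \o (lQ L' \o coder_ext l Phi j)) \+ (l j \o lQ L))) => w /=.
have [N hN] := conv_limP (size w).+1 lim.
have wM : sym_lt (maxn N (size w)).+1 (wgen w).
  by apply: sym_lt_wgen; rewrite ltnS leq_maxr.
rewrite -(hN _ (leqW (leq_maxl N (size w)))); last exact: sym_lt_wgen.
exact: flow_sum.
Qed.

End Flow.

(** * Integrating the flow to a path of coalgebra maps *)

Section PathOfMorphisms.
Variables (K : fieldType) (L L' : linf_algebra K).
Local Notation C := (Sym (shift1 L)).
Local Notation C' := (Sym (shift1 L')).
Local Notation V' := (shift1 L').
Variables (F0 : linf_morphism L L') (l : nat -> {linear C -> V'}).

(** The graded commutator of Psi, of degree -1, with the codifferentials. *)
Definition bracketQ (Psi : {linear C -> C'}) : {linear C -> C'} :=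
  (lQ L' \o Psi) \+ (Psi \o lQ L).

(** [stage j] has the right coefficients up to t^j; its values beyond j repeat
    the last one, so that it is a series to which [coder_ext] applies. *)
Fixpoint stage j : nat -> {linear C -> C'} :=
  if j is j'.+1 then fun i =>
    if (i <= j')%N then stage j' i
    else (j'.+1%:R)^-1 \*: bracketQ (coder_ext l (stage j') j')
  else fun _ => lmor F0.

(** The solution of dPhi/dt = Q' Lambda + Lambda Q with Phi(0) = F0, where
    Lambda is the coderivation along Phi with projection l. *)
Definition mor_path j := stage j j.

Lemma stageE i j : (i <= j)%N -> stage j i = mor_path i.
Proof.
elim: j => [|j IH]; first by rewrite leqn0 => /eqP ->.
by rewrite leq_eqVlt => /orP[/eqP -> //|]; rewrite ltnS /= => ij; rewrite ij IH.
Qed.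

Hypothesis charK : [pchar K] =i pred0.

Lemma mor_pathS j x :
  j.+1%:R *: mor_path j.+1 x = bracketQ (coder_ext l mor_path j) x.
Proof.
rewrite /mor_path /= ltnn /= scalerA mulfV ?natr_neq0 // scale1r.
have e : coder_ext l (stage j) j =1 coder_ext l mor_path j.
  by apply: eq_coder_ext => i ij y; rewrite stageE.
by rewrite !e.
Qed.

Hypothesis l_conv : forall j, conv_degree (-1) (l j).

Lemma stage_degree j i : @of_degree K (gSym (shift1 L)) (gSym V') 0 (stage j i).
Proof.
elim: j i => [|j IH] i /=; first exact: lmor_degree.
case: ifP => _; first exact: IH.
have dl := degree_coder_ext j (fun i => (l_conv i).1) IH.
move=> e v hv; apply: homogZ; apply: homogD.
  by have := lQ_degree (dl _ _ hv); rewrite addr0 subrK.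
by have := dl _ _ (lQ_degree hv); rewrite addr0 addrK.
Qed.

Lemma stage_filtered j i : fil_compat (sym_fil (V := shift1 L) (lfil L))
  (sym_fil (V := shift1 L') (lfil L')) (stage j i).
Proof.
elim: j i => [|j IH] i /=; first exact: lmor_filtered.
case: ifP => _; first exact: IH.
have fl := @fil_coder_ext K (shift1 L) (shift1 L') _ _ l (stage j) j
  (fun i => (l_conv i).2) IH.
move=> k x hx; rewrite /= -[X in sym_fil _ _ X]addr0.
apply: wspan_lin; last exact: wspan0.
rewrite -[X in X + _]scale1r; apply: wspan_lin.
  by apply: lQ_filtered; apply: fl.
by apply: fl; apply: lQ_filtered.
Qed.

Lemma mor_path_degree j : @of_degree K (gSym (shift1 L)) (gSym V') 0 (mor_path j).
Proof. exact: stage_degree. Qed.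

Lemma coder_ext_path_degree j :
  @of_degree K (gSym (shift1 L)) (gSym V') (-1) (coder_ext l mor_path j).
Proof. by apply: degree_coder_ext mor_path_degree => i; case: (l_conv i). Qed.

End PathOfMorphisms.

(** * The path consists of L-infinity morphisms *)

Section PathCoalgebra.
Variables (K : fieldType) (L L' : linf_algebra K).
Local Notation C := (Sym (shift1 L)).
Local Notation C' := (Sym (shift1 L')).
Local Notation V' := (shift1 L').

(** The commutator of a coderivation with the codifferentials is a coderivation,
    of degree 0.  The cross terms cancel in pairs: Q on one factor and A or B
    on the other anticommute, because P and R commute with Q. *)
Lemma bracketQ_coder (A B P R : {linear C -> C'}) z :
  @of_degree K (gSym (shift1 L)) (gSym V') (-1) A ->
  @of_degree K (gSym (shift1 L)) (gSym V') 0 P ->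
  (forall x, lQ L' (P x) = P (lQ L x)) -> (forall x, lQ L' (R x) = R (lQ L x)) ->
  let S : {linear tensor C C -> tensor C' C'} :=
    tmap A R \+ tmap (P \o twist (-1)) B in
  tmap (lQ L') idfun (S z) + tmap (twist 1) (lQ L') (S z) +
  S (tmap (lQ L) idfun z + tmap (twist 1) (lQ L) z) =
  tmap (bracketQ A) R z + tmap P (bracketQ B) z.
Proof.
move=> dA dP QP QR S.
have twA y : twist 1 (A y) = - A (twist 1 y).
  by rewrite (twist_deg _ dA) mul1r sgnN1 scaleN1r.
have twP y : twist 1 (P y) = P (twist 1 y).
  by rewrite (twist_deg _ dP) mulr0 expr0z scale1r.
have twQ y : twist 1 (lQ L y) = - lQ L (twist 1 y).
  by rewrite (twist_deg _ (@lQ_degree _ L)) mul1r expr1z scaleN1r.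
apply: (@tens_ext _ _ _ _
  ((tmap (lQ L') idfun \o S) \+ (tmap (twist 1) (lQ L') \o S) \+
   (S \o (tmap (lQ L) idfun \+ tmap (twist 1) (lQ L))))
  (tmap (bracketQ A) R \+ tmap P (bracketQ B))) => u v /=.
rewrite !tmapE /= !linearD /= !tmapE /= !twistN.
rewrite !twA !twP !twQ !twistK QP QR linearN /=.
rewrite !tensNl !tensDl !tensDr.
by rewrite [LHS](AC ((2*2)*(2*2)) ((1*5)*(4*8)*((2*7)*(6*3)))) /= !subrr !addr0.
Qed.

End PathCoalgebra.

Section PathInvariants.
Variables (K : fieldType) (L L' : linf_algebra K).
Local Notation C := (Sym (shift1 L)).
Local Notation C' := (Sym (shift1 L')).
Local Notation V' := (shift1 L').
Hypothesis charK : [pchar K] =i pred0.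
Variables (F0 : linf_morphism L L') (l : nat -> {linear C -> V'}).
Hypothesis l_conv : forall j, conv_degree (-1) (l j).
Local Notation P := (mor_path F0 l).
Local Notation Lam := (coder_ext l P).

Definition commutes_Q j := forall x, lQ L' (P j x) = P j (lQ L x).

(** The coproduct of (j + 1) Phi_{j+1} = [Q, Lambda_j] is given by
    [bracketQ_coder] as the sum of the terms (i + 1) Phi_{i+1} (x) Phi_{j-i}
    and Phi_i (x) (j - i + 1) Phi_{j-i+1}, which is the Leibniz rule for
    the derivative of the series of the Phi_i (x) Phi_k. *)
Lemma coalg_path j : (forall i, (i <= j)%N -> coalg_at P i) ->
  (forall i, (i <= j)%N -> commutes_Q i) -> coalg_at P j.+1.
Proof.
move=> cP QP x; apply: (scalerI (natr_neq0 charK j)).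
pose S i : {linear tensor C C -> tensor C' C'} :=
  tmap (Lam i) (P (j - i)%N) \+ tmap (P i \o twist (-1)) (Lam (j - i)%N).
have cL y : coprod (Lam j y) = \sum_(i < j.+1) S i (coprod y).
  have dl i := (l_conv i).1.
  exact: (coder_ext_coder dl (mor_path_degree F0 l_conv) cP y).
pose T p q := tmap (P p) (P q) (coprod x).
transitivity (\sum_(i < j.+1)
    (i.+1%:R *: T i.+1 (j - i)%N + (j - i).+1%:R *: T i (j - i).+1)).
  rewrite -linearZ /= mor_pathS // /bracketQ /= linearD /= lQ_coder !cL lQ_coder.
  rewrite ![tmap _ _ (\sum_(_ < _) _)]linear_sum.
  rewrite -[X in X + _ = _]big_split -[LHS]big_split; apply: eq_bigr => i _ /=.
  have ij : (i <= j)%N by rewrite -ltnS.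
  have := @bracketQ_coder _ _ _ (Lam i) (Lam (j - i)%N) (P i) (P (j - i)%N)
    (coprod x) (coder_ext_path_degree F0 l_conv i) (mor_path_degree F0 l_conv i)
    (QP i ij) (QP (j - i)%N (leq_subr _ _)).
  move=> /= ->; rewrite /T -tmapZl -tmapZr.
  by congr (_ + _); apply: eq_tmap => y //=; rewrite mor_pathS.
transitivity (\sum_(i < j.+2) (i%:R *: T i (j.+1 - i)%N) +
    \sum_(i < j.+2) ((j.+1 - i)%:R *: T i (j.+1 - i)%N)).
  rewrite big_split; congr (_ + _) => /=.
    by rewrite [RHS]big_ord_recl scale0r add0r; apply: eq_bigr => i _.
  rewrite [RHS]big_ord_recr /= subnn scale0r addr0; apply: eq_bigr => i _.
  by rewrite subSn // -ltnS.
rewrite -big_split scaler_sumr; apply: eq_bigr => i _ /=.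
by rewrite -scalerDl -natrD subnKC // -ltnS.
Qed.

Variable a : nat -> {linear C -> V'}.
Hypothesis a0 : forall x, sym_proj (lmor F0 x) = a 0%N x.
Hypothesis flow : forall j, conv_lim
  (fun N x => \sum_(n < N) (n`!%:R)^-1 *: conv_flow a l n j x)
  (fun x => j.+1%:R *: a j.+1 x).

(** The three claims need one induction: comultiplicativity of Phi_{j+1} uses
    that the lower coefficients commute with Q, and the identification of the
    flow equation uses that they are comultiplicative with projection a. *)
Lemma mor_path_spec j :
  [/\ coalg_at P j, forall x, sym_proj (P j x) = a j x & commutes_Q j].
Proof.
have [m jm] : exists m, (j <= m)%N by exists j.
elim: m j jm => [|m IH] j.
  rewrite leqn0 => /eqP ->; split=> x //=; last by rewrite lmor_Q.
  by rewrite big_ord1 lmor_coalg.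
rewrite leq_eqVlt => /orP[/eqP ->|]; last exact: IH.
have cP i : (i <= m)%N -> coalg_at P i by move/IH; case.
have pP i x : (i <= m)%N -> sym_proj (P i x) = a i x by move/IH; case.
have QP i : (i <= m)%N -> commutes_Q i by move/IH; case.
split; first exact: coalg_path.
  move=> x; apply: (scalerI (natr_neq0 charK m)).
  rewrite ((@flow_coder_ext _ _ _ charK a l P m cP pP).1 (flow m)).
  rewrite -linearZ /= mor_pathS //.
  by rewrite linearD /= proj_coder_ext.
move=> x; apply: (scalerI (natr_neq0 charK m)).
rewrite -[LHS]linearZ /= !mor_pathS // /bracketQ /= !linearD /=.
by rewrite !lQ_square !linear0 !add0r addr0.
Qed.

End PathInvariants.

(** * Convergence of the path, and its image under H *)

Section PathConvergence.
Variables (K : fieldType) (L L' : linf_algebra K).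
Local Notation C := (Sym (shift1 L)).
Local Notation C' := (Sym (shift1 L')).
Local Notation V' := (shift1 L').
Hypothesis charK : [pchar K] =i pred0.
Variables (F0 F1 : linf_morphism L L') (a l : nat -> {linear C -> V'}).
Hypothesis l_series : conv_series (-1) l.
Hypothesis flow : forall j, conv_lim
  (fun N x => \sum_(n < N) (n`!%:R)^-1 *: conv_flow a l n j x)
  (fun x => j.+1%:R *: a j.+1 x).
Hypothesis a0 : forall x, sym_proj (lmor F0 x) = a 0%N x.
Hypothesis a1 : conv_eval 1 a (sym_proj \o lmor F1).
Local Notation P := (mor_path F0 l).

Lemma mor_path_sum m : exists N, forall M, (N <= M)%N ->
  forall w : word (shift1 L), (size w < m)%N ->
  \sum_(j < M) P j (wgen w) = lmor F1 (wgen w).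
Proof.
have spec := mor_path_spec charK l_series.1 a0 flow.
apply: (coalg_sum charK) m => [j||m]; first by case: (spec j).
  exact: lmor_coalg.
have [N hN] := conv_limP m a1; exists N => M NM w wm.
rewrite -[RHS](hN M NM _ (sym_lt_wgen wm)); apply: eq_bigr => j _.
by rewrite expr1n scale1r; case: (spec j).
Qed.

Lemma mor_path_vanish m : exists N, forall j, (N <= j)%N ->
  forall w : word (shift1 L), (size w < m)%N -> P j (wgen w) = 0.
Proof.
have [N hN] := mor_path_sum m; exists N => j Nj w wm.
have := hN j.+1 (leqW Nj) w wm.
by rewrite big_ord_recr /= hN // => /(canRL (addKr _)); rewrite addNr.
Qed.

(** In each term l_i . Phi_{j-i} one of the two indices is large. *)
Lemma coder_ext_path_vanish m : exists N, forall j, (N <= j)%N ->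
  forall w : word (shift1 L), (size w < m)%N -> coder_ext l P j (wgen w) = 0.
Proof.
have [N hN] := mor_path_vanish m; have [N' hN'] := l_series.2 m.
exists (N + N')%N => j jN w wm.
have vl i u : (N' <= i)%N -> (size u < m)%N -> l i (wgen u) = 0.
  by move=> Ni um; apply: (hN' i Ni); apply: sym_lt_wgen.
rewrite /coder_ext vl ?linear0 ?add0r //; last by lia.
rewrite big1 // => i _; rewrite star_wgen -[RHS](usum0 _ w).
apply: eq_usum_in => u v uv _ /=.
case: (leqP N' i) => [Ni|iN]; first by rewrite vl ?linear0 ?smul0r //; lia.
by rewrite hN ?smulr0 //; lia.
Qed.

End PathConvergence.

Section Pushforward.
Variables (K : fieldType) (L L' L'' : linf_algebra K).
Local Notation C := (Sym (shift1 L)).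
Local Notation C' := (Sym (shift1 L')).
Local Notation C'' := (Sym (shift1 L'')).
Local Notation V'' := (shift1 L'').
Hypothesis charK : [pchar K] =i pred0.
Variable H : linf_morphism L' L''.

Definition push (Psi : nat -> {linear C -> C'}) j : {linear C -> V''} :=
  sym_proj \o (lmor H \o Psi j).

Lemma push_series k (Psi : nat -> {linear C -> C'}) :
  (forall j, @of_degree K (gSym (shift1 L)) (gSym (shift1 L')) k (Psi j)) ->
  (forall j, fil_compat (@sym_fil K (shift1 L) (lfil L))
                        (@sym_fil K (shift1 L') (lfil L')) (Psi j)) ->
  (forall m, exists N, forall j, (N <= j)%N ->
     forall w : word (shift1 L), (size w < m)%N -> Psi j (wgen w) = 0) ->
  conv_series k (push Psi).
Proof.
move=> dPsi fPsi vPsi; split=> [j|m].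
  split=> [i v hv|i x hx] /=.
    by have := degree_proj (lmor_degree H (dPsi j _ _ hv)); rewrite !addr0.
  apply: (@fil_proj K (shift1 L'') (lfil L'')).
    have [F0 FL Fgpr] := fil_sub (lfil L''); split=> // k' i' v; exact: Fgpr.
  by apply: lmor_filtered; apply: fPsi.
have [N hN] := vPsi m; exists N => j Nj x.
apply: (wspan_ind (Q := fun y => y = 0) (f := push Psi j)) => //.
  by move=> c y z -> ->; rewrite scaler0 addr0.
by move=> w wm; rewrite /= hN // !linear0.
Qed.

(** The homotopy is the projection of H Phi and H Lambda.  The flow equation
    for it involves the coderivation along H Phi with projection that of
    H Lambda, which is H Lambda by uniqueness. *)
Lemma elementary_homotopy_comp (F0 F1 : linf_morphism L L') :
  elementary_homotopy F0 F1 ->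
  elementary_homotopy (linf_comp H F0) (linf_comp H F1).
Proof.
move=> [a [l [_ l_series flow ev0 ev1]]].
have a0 x : sym_proj (lmor F0 x) = a 0%N x.
  move: x; apply: (@sym_ext _ _ _ (sym_proj \o lmor F0) (a 0%N)) => w /=.
  have [N hN] := conv_limP (size w).+1 ev0.
  rewrite -[LHS](hN N.+1 (leqnSn _) _ (sym_lt_wgen (ltnSn _))) /=.
  rewrite big_ord_recl expr0 scale1r big1 ?addr0 // => i _.
  by rewrite expr0n scale0r.
pose P := mor_path F0 l; pose Lam := coder_ext l P.
have spec := mor_path_spec charK l_series.1 a0 flow.
pose HP j : {linear C -> C''} := lmor H \o P j.
pose HL j : {linear C -> C''} := lmor H \o Lam j.
have HP_degree j : @of_degree K (gSym (shift1 L)) (gSym V'') 0 (HP j).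
  move=> i v hv; have := lmor_degree H (mor_path_degree F0 l_series.1 j hv).
  by rewrite !addr0.
have HP_coalg j : coalg_at HP j.
  move=> x; have [cP _ _] := spec j; rewrite /= lmor_coalg cP linear_sum.
  by apply: eq_bigr => i _; rewrite /= tmap_comp.
have a_series : conv_series 0 (push P).
  apply: push_series; first exact: mor_path_degree l_series.1.
    by move=> j; apply: stage_filtered l_series.1 _ _.
  exact: (mor_path_vanish charK l_series flow a0 ev1).
have Lam_series : conv_series (-1) (push Lam).
  apply: push_series.
  - by move=> j; apply: coder_ext_path_degree l_series.1 j.
  - move=> j; apply: fil_coder_ext => i; first by case: (l_series.1 i).
    exact: stage_filtered l_series.1 _ _.
  - exact: (coder_ext_path_vanish charK l_series flow a0 ev1).
exists (push P), (push Lam); split=> //.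
- move=> j; apply/(@flow_coder_ext _ _ _ charK _ _ HP) => // x.
  have -> : coder_ext (push Lam) HP j x = HL j x.
    apply: (coder_unique charK (d := -1) (Phi := HP)) => {j x} [j|j|j x].
    + apply: coder_ext_coder => // i; exact: (Lam_series.1 i).1.
    + move=> x; rewrite /= lmor_coalg.
      have cL := coder_ext_coder (fun i => (l_series.1 i).1)
        (mor_path_degree F0 l_series.1) (j := j)
        (fun i _ => let: And3 c _ _ := spec i in c).
      rewrite cL linear_sum; apply: eq_bigr => i _.
      by rewrite linearD /= !tmap_comp.
    + by rewrite proj_coder_ext.
  rewrite /= -linearZ /= -linearZ /= mor_pathS //= -/P -/(Lam j).
  by move: (Lam j x) (Lam j (lQ L x)) => y z; rewrite !linearD /= lmor_Q.
- move=> m; exists 1%N => -[//|M] _ x _.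
  rewrite big_ord_recl /= expr0 scale1r big1 ?addr0 ?subrr // => i _.
  by rewrite expr0n scale0r.
move=> m; have [N hN] := mor_path_sum charK l_series flow a0 ev1 m.
exists N => M NM x.
apply: (wspan_ind (Q := fun y => y = 0)
  (f := (sym_proj \o (lmor H \o lmor F1)) \- lsum M (fun j => 1 ^+ j \*: push P j)))
  => //.
  by move=> c y z -> ->; rewrite scaler0 addr0.
move=> w wm /=; rewrite -(hN M NM w wm).
rewrite [lmor H (\sum_(_ < _) _)]linear_sum /= [sym_proj _]linear_sum -sumrB.
rewrite big1 // => j _.
by rewrite expr1n scale1r subrr.
Qed.

End Pushforward.

Theorem proposition3p5 (K : fieldType) (charK : [pchar K]%R =i pred0)
  (L L' L'' : linf_algebra K)
  (F0 F1 : linf_morphism L L') (H : linf_morphism L' L'') :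
  homotopic F0 F1 -> homotopic (linf_comp H F0) (linf_comp H F1).
Proof.
elim=> [F F' FF'|F F' F'' _ HF _ HF']; last exact: t_trans HF HF'.
exact/t_step/elementary_homotopy_comp.
Qed.
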